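(* Let $I$ be a finite nonempty set, $r\ge1$, $d\ge0$ integers, $i_0\in I$, and let $\mathcal C=(\mathbb P^1,(p_\lambda)_{\lambda\in L_0},f)$ be a labeled parametrized $I$-marked curve of degree $d$ in $\mathbb P^r$ in standard form, with corresponding tropical curve $\mathfrak C_{\mathcal C}$. Then the point corresponding to $\mathfrak C_{\mathcal C}$ in $\mathfrak M^{\mathrm{lab}}_{0,I}(r,d)\subseteq\mathbb R^{D(L_0)}/\operatorname{Im}\Phi\times\mathfrak T^r$ is the tropicalization of the point in $M^{\mathrm{lab}}_{0,I}(r,d)\subseteq\mathbb G_m^{D(L_0)}/\mathbb G_m^{L_0}\times\mathbb T^r$ corresponding to $\mathcal C$.
   Context: Ground field: $(K,\nu)$ is an algebraically closed valued field of characteristic $0$ (valuation possibly trivial), $\nu(0)=\infty$. For a set $S$, $D(S)$ is the set of ordered pairs of distinct elements of $S$. $\mathbb T^r\subset\mathbb P^r$ is the torus of points with all coordinates nonzero; $\mathfrak T^r=\mathbb R^{r+1}/\mathbb R(1,\dots,1)$ with lattice $N$ the image of $\mathbb Z^{r+1}$; $s_i$ is the image of the $i$-th standard basis vector. For an algebraic torus with character lattice $M'$, the tropicalization of a $K$-point $x$ is $(m\mapsto\nu(m(x)))\in\operatorname{Hom}(M',\mathbb R)$. Let $J=\{0,\dots,r\}\times\{1,\dots,d\}$ and $L_0=I\cup J$ (disjoint union); it is assumed that $|L_0|\ge3$. Algebraic curves: $M^{\mathrm{lab}}_{0,I}(r,d)$ is the set of isomorphism classes of labeled parametrized $I$-marked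 rational curves of degree $d$ in $\mathbb P^r$, i.e. of $(C,(p_\lambda)_{\lambda\in L_0},f)$ with $C\cong\mathbb P^1$, distinct points $p_\lambda\in C$, and $f:C\to\mathbb P^r$ a morphism of degree $d$ ($f_*[C]=d$) such that $f^{-1}(\{x_i=0\})=\{p_{ij}\mid1\le j\le d\}$ for each $i=0,\dots,r$. The space is embedded in $\mathbb G_m^{D(L_0)}/\mathbb G_m^{L_0}\times\mathbb T^r$ by writing $C=\mathbb P^1$, $p_\lambda=(b_\lambda:a_\lambda)$ and sending the curve to $([(b_\lambda a_\mu-a_\lambda b_\mu)_{(\lambda,\mu)}],f(p_{i_0}))$, where $(x_\lambda)\in\mathbb G_m^{L_0}$ acts through $(x_\lambda x_\mu)_{(\lambda,\mu)}$. Tropical curves: an abstract rational tropical curve is a finite metric tree $\mathfrak C=(V,E,\ell)$, $\ell:E\to\mathbb R_{>0}\cup\{\infty\}$, without $2$-valent vertices and not consisting of exactly two vertices, such that the edges of infinite length are exactly those incident to a $1$-valent vertex (''legs''; the $1$-valent vertices are ''feet'', other vertices ''inner''); $\mathfrak C^\circ$ is $\mathfrak C$ without the feet. $\mathfrak M^{\mathrm{lab}}_{0,I}(r,d)$ is the set of isomorphism classes of $(\mathfrak C,(e_\lambda)_{\lambda\in L_0},\mathfrak f)$, where $\lambda\mapsto e_\lambda$ is a bijection from $L_0$ to the legs and $\mathfrak f:\mathfrak C^\circ\to\mathfrak T^r$ is continuous and affine linear on edges, with all direction vectors (derivative of $\mathfrak f|_e$ away from the inner vertex $v\in e$, with respect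 to length) in $N$, balanced (the direction vectors at every inner vertex sum to $0$), with direction $s_i$ on $e_{(i,j)}$ for $(i,j)\in J$ and direction $0$ on $e_i$ for $i\in I$. $\mathfrak{ev}_{i_0}$ sends the curve to the point $\mathfrak f(e_{i_0})$. With $\operatorname{dist}_{\mathfrak C}(\lambda,\mu)$ the distance between the inner vertices incident to $e_\lambda,e_\mu$ and $\Phi:\mathbb R^{L_0}\to\mathbb R^{D(L_0)}$, $(x_\lambda)\mapsto(x_\lambda+x_\mu)_{(\lambda,\mu)}$, the point corresponding to the curve is $([(-\operatorname{dist}_{\mathfrak C}(\lambda,\mu)/2)_{(\lambda,\mu)}],\mathfrak{ev}_{i_0})\in\mathbb R^{D(L_0)}/\operatorname{Im}\Phi\times\mathfrak T^r$, the latter being the tropicalization of $\mathbb G_m^{D(L_0)}/\mathbb G_m^{L_0}\times\mathbb T^r$. Standard form and corresponding tropical curve: $\mathcal C$ is in standard form if $C=\mathbb P^1$ and $p_{i_0}=(0:1)$; then $p_\lambda=(1:a_\lambda)$ with unique $a_\lambda\in K$ for $\lambda\in L:=L_0\setminus\{i_0\}$. Write $f(p_{i_0})=(c_0:\dots:c_r)$. For nonempty $A\subseteq L$ let $\nu(A)=\min\{\nu(a_\mu-a_\lambda)\mid\lambda,\mu\in A\}\in\mathbb R\cup\{\infty\}$. Let $V$ be the set of nonempty $A\subseteq L$ which are maximal for the partial order $A\preceq B:\Leftrightarrow A\subseteq B$ and $\nu(A)=\nu(B)$. Order $V$ by inclusion and connect two elements by an edge iff one covers the other; this is a tree with vertex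 $L$. Give the edge $\{v\subset w\}$ length $\nu(v)-\nu(w)$, and attach an additional foot $\{i_0\}$ to $L$ along a leg; this is an abstract tropical curve $\mathfrak C$ whose leg $e_\lambda$ is the one with foot $\{\lambda\}$, $\lambda\in L_0$. For $A\subseteq L_0$ let $s_A=\sum_{i=0}^r|A\cap(\{i\}\times\{1,\dots,d\})|\,s_i$. For an inner vertex $v$ with path $L=v_0,v_1,\dots,v_k=v$ from $L$, let $q_v=\sum_{i=0}^r\nu(c_i)s_i+\sum_{i=1}^k\ell(\{v_i,v_{i-1}\})s_{v_i}$. Let $\mathfrak f:\mathfrak C^\circ\to\mathfrak T^r$ send each inner vertex $v$ to $q_v$, interpolate linearly on bounded edges, and have direction $s_v$ on the leg with foot $v$. Then $\mathfrak C_{\mathcal C}=(\mathfrak C,(e_\lambda),\mathfrak f)$ is a curve in $\mathfrak M^{\mathrm{lab}}_{0,I}(r,d)$, called the corresponding tropical curve to $\mathcal C$. *)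

(* Defs.v *)
From HB Require Import structures.
From mathcomp Require Import all_boot all_order all_algebra.
From mathcomp Require Import generic_quotient ring_quotient.
From mathcomp Require Import zify lra.
From mathcomp Require Import boolp classical_sets constructive_ereal reals ereal.

Set Implicit Arguments.
Unset Strict Implicit.
Unset Printing Implicit Defensive.

Import Order.TTheory GRing.Theory Num.Theory.
Local Open Scope quotient_scope.
Local Open Scope ring_scope.

(* The trivial valuation is allowed. *)
Definition valuation (R : realType) (K : fieldType) (nu : K -> \bar R) : Prop :=
  [/\ forall x, nu x != -oo%E,
      forall x, nu x = +oo%E <-> x = 0,
      forall x y, nu (x * y) = (nu x + nu y)%E
    & forall x y, (Order.min (nu x) (nu y) <= nu (x + y)%R)%E].

(* The label (i, j) of J = {0..r} x {1..d} is [inr (i, j)], with j shifted to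
   {0..d-1}. *)
Definition label (I : finType) (r d : nat) : finType :=
  (I + 'I_r.+1 * 'I_d)%type.

(* D(S) *)
Definition dpairs (S : finType) : finType := {p : S * S | p.1 != p.2}.

Section Projective.
Variables (K : fieldType) (n : nat).

Definition nzvec : Type := {v : 'rV[K]_n.+1 | v != 0}.
HB.instance Definition _ := Choice.on nzvec.

Definition proj_eqv (u v : nzvec) : bool :=
  `[< exists2 t : K, t != 0 & val v = t *: val u >].

Fact proj_eqv_equiv : equiv_class_of proj_eqv.
Proof.
split=> [u|u v|v u w].
- by apply/asboolP; exists 1; rewrite ?oner_eq0 ?scale1r.
- by apply/asboolP/asboolP => -[t t0 e]; exists t^-1; rewrite ?invr_eq0 // e
    scalerA mulVf ?scale1r.
- move=> /asboolP[s s0 es] /asboolP[t t0 et]; apply/asboolP.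
  by exists (t * s); rewrite ?mulf_neq0 // et es scalerA.
Qed.
Canonical proj_equiv := EquivRelPack proj_eqv_equiv.

Definition proj : Type := {eq_quot proj_eqv}.
HB.instance Definition _ := Choice.on proj.
HB.instance Definition _ := EqQuotient.on proj.

(* some homogeneous coordinates of P *)
Definition hc (P : proj) : 'rV[K]_n.+1 := val (repr P).

(* P = (v_0 : ... : v_n) *)
Definition has_coords (P : proj) (v : 'rV[K]_n.+1) : Prop :=
  exists u : nzvec, P = \pi_proj u /\ v = val u.

Lemma hc_coords P : has_coords P (hc P).
Proof. by exists (repr P); rewrite reprK. Qed.

Lemma has_coordsP P v :
  has_coords P v <-> exists2 t, t != 0 & v = t *: hc P.
Proof.
split=> [[u [-> ->]]|[t t0 ->]].
  have /eqmodP/asboolP : repr (\pi_proj u) = u %[mod proj] by rewrite reprK.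
  by case=> t t0 e; exists t.
have nz : t *: hc P != 0 by rewrite scaler_eq0 negb_or t0; apply: (valP (repr P)).
exists (Sub (t *: hc P) nz); split; last by [].
rewrite -[P in LHS]reprK; apply/eqmodP/asboolP; exists t => //.
Qed.

(* {x_i = 0} *)
Definition coord_zero (i : 'I_n.+1) (P : proj) : bool := hc P 0 i == 0.

End Projective.

(* (b : a) *)
Definition vec2 (K : fieldType) (b a : K) : 'rV[K]_2 :=
  \row_(k < 2) (if k == 0 then b else a).

Definition ptorus (K : fieldType) (r : nat) : Type :=
  {P : proj K r | [forall i, ~~ coord_zero i P]}.

Section Curves.
Variables (K : fieldType) (I : finType) (r d : nat).

(* the binary form of degree d with coefficients F, evaluated at v *)
Definition binary_form (F : 'I_d.+1 -> K) (v : 'rV[K]_2) : K :=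
  \sum_(k < d.+1) F k * v 0 0 ^+ k * v 0 1 ^+ (d - k).

(* Over an algebraically closed field a morphism P^1 -> P^r with f_*[P^1] = d
   is a map on points given by r+1 binary forms of degree d without common
   zero; the absence of common zeros is part of [has_coords]. *)
Definition morphism_of_degree (f : proj K 1 -> proj K r) : Prop :=
  exists F : 'I_r.+1 -> 'I_d.+1 -> K,
    forall (P : proj K 1) (v : 'rV[K]_2), has_coords P v ->
      has_coords (f P) (\row_i binary_form (F i) v).

Record lab_curve : Type := LabCurve {
  mark : label I r d -> proj K 1;
  cmap : proj K 1 -> proj K r;
  mark_inj : injective mark;
  cmap_degree : morphism_of_degree cmap;
  cmap_fibre : forall (i : 'I_r.+1) (P : proj K 1),
    coord_zero i (cmap P) <-> exists j : 'I_d, P = mark (inr (i, j)) }.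

Definition standard_form (i0 : I) (C : lab_curve) : Prop :=
  has_coords (mark C (inl i0)) (vec2 0 1).

End Curves.

Section PairTorus.
Variables (K : fieldType) (S : finType).

Definition gm (T : finType) : Type :=
  {x : {ffun T -> K} | [forall s, x s != 0]}.
HB.instance Definition _ T := Choice.on (gm T).

Definition mkgm (T : finType) (x : {ffun T -> K}) (h : [forall s, x s != 0]) : gm T :=
  exist (fun y : {ffun T -> K} => [forall s, y s != 0]) x h.

Definition pt_eqv (x y : gm (dpairs S)) : bool :=
  `[< exists t : gm S, forall p : dpairs S,
        val y p = val t (val p).1 * val t (val p).2 * val x p >].

Fact pt_eqv_equiv : equiv_class_of pt_eqv.
Proof.
have nz (t : gm S) s : val t s != 0 by exact: (forallP (valP t)).
split=> [x|x y|y x z].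
- have h : [forall s, [ffun _ : S => (1 : K)] s != 0].
    by apply/forallP => s; rewrite ffunE oner_eq0.
  by apply/asboolP; exists (mkgm h) => p; rewrite /= !ffunE !mul1r.
- have inv (t : gm S) : [forall s, [ffun s => (val t s)^-1] s != 0].
    by apply/forallP => s; rewrite ffunE invr_eq0 nz.
  by apply/asboolP/asboolP => -[t e]; exists (mkgm (inv t)) => p;
    rewrite e /= !ffunE -invfM mulKf ?mulf_neq0 ?nz.
- move=> /asboolP[t et] /asboolP[u eu]; apply/asboolP.
  have h : [forall s, [ffun s => val u s * val t s] s != 0].
    by apply/forallP => s; rewrite ffunE mulf_neq0 ?nz.
  by exists (mkgm h) => p; rewrite eu et /= !ffunE !mulrA;
    congr (_ * _ * _); exact: mulrAC.
Qed.
Canonical pt_equiv := EquivRelPack pt_eqv_equiv.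

Definition pair_torus : Type := {eq_quot pt_eqv}.
HB.instance Definition _ := Choice.on pair_torus.
HB.instance Definition _ := EqQuotient.on pair_torus.

End PairTorus.

Section CurvePoint.
Variables (K : fieldType) (I : finType) (r d : nat) (C : lab_curve K I r d).

(* b_l a_m - a_l b_m for p_l = (b_l : a_l) *)
Definition bracket (p : dpairs (label I r d)) : K :=
  let u := hc (mark C (val p).1) in let v := hc (mark C (val p).2) in
  u 0 0 * v 0 1 - u 0 1 * v 0 0.

Fact bracket_neq0 : [forall p, finfun bracket p != 0].
Proof.
apply/forallP => p; rewrite ffunE /bracket; apply/negP => /eqP.
set P := mark C _; set Q := mark C _ => /eqP; rewrite subr_eq0 => /eqP e.
have neq : P != Q by rewrite (inj_eq (@mark_inj _ _ _ _ C)) (valP p).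
move/negP: neq; apply; apply/eqP.
have ord2 (k : 'I_2) : k = 0 \/ k = 1.
  by case: k => [[|[|//]] h]; [left|right]; apply/val_inj.
have rowE (v w : 'rV[K]_2) : v 0 0 = w 0 0 -> v 0 1 = w 0 1 -> v = w.
  by move=> e0 e1; apply/rowP => k; case: (ord2 k) => ->.
have nzQ : hc Q != 0 := valP (repr Q); have nzP : hc P != 0 := valP (repr P).
suff [t t0 et] : exists2 t, t != 0 & hc Q = t *: hc P.
  by rewrite -[P]reprK -[Q]reprK; apply/eqmodP/asboolP; exists t.
have [p0|p0] := eqVneq (hc P 0 0) 0.
  have p1 : hc P 0 1 != 0.
    by apply: contraNneq nzP => p1; apply/eqP/rowE; rewrite ?p0 ?p1 mxE.
  have q0 : hc Q 0 0 = 0.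
    apply/eqP; move/eqP: e; rewrite p0 mul0r eq_sym mulf_eq0.
    by rewrite (negPf p1).
  have q1 : hc Q 0 1 != 0.
    by apply: contraNneq nzQ => q1; apply/eqP/rowE; rewrite ?q0 ?q1 mxE.
  exists (hc Q 0 1 / hc P 0 1); first by rewrite mulf_neq0 ?invr_eq0.
  by apply: rowE; rewrite mxE ?p0 ?q0 ?mulr0 // divfK.
have q0 : hc Q 0 0 != 0.
  apply: contraNneq nzQ => q0; apply/eqP/rowE; rewrite ?q0 mxE //.
  apply/eqP; move/eqP: e; rewrite q0 mulr0 mulf_eq0.
  by rewrite (negPf p0).
exists (hc Q 0 0 / hc P 0 0); first by rewrite mulf_neq0 ?invr_eq0.
apply: rowE; rewrite mxE ?divfK // mulrAC [_ * hc P 0 1]mulrC -e mulrC mulKf //.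
Qed.

Definition brackets : gm K (dpairs (label I r d)) :=
  mkgm bracket_neq0.

Fact cmap_torus (i : I) :
  [forall k, ~~ coord_zero k (cmap C (mark C (inl i)))].
Proof.
by apply/forallP => k; apply/negP => /cmap_fibre[j] /(@mark_inj _ _ _ _ C).
Qed.

Definition ev (i : I) : ptorus K r :=
  exist (fun P : proj K r => [forall k, ~~ coord_zero k P]) _ (cmap_torus i).

Definition curve_point (i0 : I) :
    pair_torus K (label I r d) * ptorus K r :=
  (\pi_(pair_torus K (label I r d)) brackets, ev i0).

End CurvePoint.

(* The character lattice of G_m^D(S)/G_m^S x T^r: the Laurent monomials
   (m, n) on G_m^D(S) x G_m^(r+1) that are invariant under the actions of
   G_m^S and of the scalars. *)
Definition is_character (S : finType) (r : nat)
    (m : {ffun dpairs S -> int} * {ffun 'I_r.+1 -> int}) : bool :=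
  [forall s : S, \sum_(p : dpairs S)
     m.1 p * (((val p).1 == s)%:R + ((val p).2 == s)%:R) == 0]
  && (\sum_i m.2 i == 0).

Definition charlattice (S : finType) (r : nat) : Type :=
  {m : {ffun dpairs S -> int} * {ffun 'I_r.+1 -> int} | is_character m}.

Definition monomial (K : fieldType) (T : finType)
    (m : {ffun T -> int}) (x : T -> K) : K := \prod_t x t ^ m t.

Definition char_eval (K : fieldType) (S : finType) (r : nat)
    (m : charlattice S r) (X : pair_torus K S * ptorus K r) : K :=
  monomial (val m).1 (val (repr X.1)) * monomial (val m).2 (hc (val X.2) 0).

Definition tropicalization (R : realType) (K : fieldType) (nu : K -> \bar R)
    (S : finType) (r : nat) (X : pair_torus K S * ptorus K r) :
    charlattice S r -> R :=
  fun m => fine (nu (char_eval m X)).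

Section PairSpace.
Variables (R : realType) (S : finType).

Definition Phi (x : S -> R) : {ffun dpairs S -> R} :=
  [ffun p => x (val p).1 + x (val p).2].

Definition imPhi : pred {ffun dpairs S -> R} :=
  fun q => `[< exists x : S -> R, q = Phi x >].

Fact imPhi_zmod_closed : zmod_closed imPhi.
Proof.
split=> [|_ _ /asboolP[x ->] /asboolP[y ->]]; apply/asboolP.
  by exists (fun=> 0); apply/ffunP => p; rewrite !ffunE addr0.
by exists (fun s => x s - y s); apply/ffunP => p; rewrite !ffunE addrACA opprD.
Qed.
HB.instance Definition _ := GRing.isZmodClosed.Build _ imPhi imPhi_zmod_closed.

Let Q := Quotient.quot (GRing.ZmodClosed.clone _ imPhi _).

Definition pair_space : zmodType := Q.
Definition pclass (q : {ffun dpairs S -> R}) : pair_space := \pi_Q q.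
Definition prepr (q : pair_space) : {ffun dpairs S -> R} := repr (q : Q).

End PairSpace.

Section TropTorus.
Variables (R : realType) (r : nat).

Definition diagonal : pred 'rV[R]_r.+1 := fun v => `[< exists t, v = const_mx t >].

Fact diagonal_zmod_closed : zmod_closed diagonal.
Proof.
split=> [|_ _ /asboolP[x ->] /asboolP[y ->]]; apply/asboolP.
  by exists 0.
by exists (x - y); apply/rowP => k; rewrite !mxE.
Qed.
HB.instance Definition _ :=
  GRing.isZmodClosed.Build _ diagonal diagonal_zmod_closed.

Let Q := Quotient.quot (GRing.ZmodClosed.clone _ diagonal _).

Definition trop_torus : zmodType := Q.

Definition tclass (v : 'rV[R]_r.+1) : trop_torus := \pi_Q v.
Definition trepr (u : trop_torus) : 'rV[R]_r.+1 := repr (u : Q).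

Definition tscale (t : R) (u : trop_torus) : trop_torus :=
  tclass (t *: trepr u).

(* the lattice N *)
Definition in_lattice (u : trop_torus) : Prop :=
  exists z : 'rV[int]_r.+1, u = tclass (map_mx intr z).

Definition svec (i : 'I_r.+1) : trop_torus := tclass (delta_mx 0 i).

End TropTorus.

(* The isomorphism R^D(S)/Im Phi x R^(r+1)/R(1,...,1) -> Hom(M', R) which
   identifies the left hand side with the tropicalization of the torus;
   see [trop_ident_inj]. *)
Definition trop_ident (R : realType) (S : finType) (r : nat)
    (q : pair_space R S * trop_torus R r) : charlattice S r -> R :=
  fun m =>
    \sum_(p : dpairs S) ((val m).1 p)%:~R * prepr q.1 p
    + \sum_(i < r.+1) ((val m).2 i)%:~R * trepr q.2 0 i.

(* The edges are the pairs {v, w} with [tadj v w].  A leg is given by its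
   foot.  A map which is continuous and affine linear on the edges is given
   by the images of the inner vertices together with the direction vectors of
   the legs: the values of [tpos] at feet, of [tleg] at inner vertices, and of
   [tlen] at non-adjacent pairs are irrelevant. *)
Record trop_data (R : realType) (I : finType) (r d : nat) : Type := TropData {
  tvert : finType;
  tadj : rel tvert;
  tlen : tvert -> tvert -> \bar R;
  tfoot : label I r d -> tvert;
  tpos : tvert -> trop_torus R r;
  tleg : tvert -> trop_torus R r }.

Arguments tadj {R I r d} _ _ _.
Arguments tlen {R I r d} _ _ _.
Arguments tfoot {R I r d} _ _.
Arguments tpos {R I r d} _ _.
Arguments tleg {R I r d} _ _.

Section TropCurves.
Variables (R : realType) (I : finType) (r d : nat) (T : trop_data R I r d).
Local Notation V := (tvert T).

Definition valence (v : V) : nat := #|[set w | tadj T v w]|.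
Definition is_foot (v : V) : bool := valence v == 1%N.

Definition is_tree : Prop :=
  [/\ symmetric (tadj T), irreflexive (tadj T),
      forall v w : V, connect (tadj T) v w
    & forall p : seq V, ucycle (tadj T) p -> (size p <= 2)%N].

Definition is_abstract_trop_curve : Prop :=
  [/\ is_tree, forall v : V, valence v != 2%N, #|V| != 2%N
    & forall v w : V, tadj T v w ->
        [/\ tlen T v w = tlen T w v, (0 < tlen T v w)%E
          & tlen T v w = +oo%E <-> is_foot v \/ is_foot w]].

(* the derivative, away from v, of the map on the edge from the inner vertex
   v to w *)
Definition direction (v w : V) : trop_torus R r :=
  if is_foot w then tleg T w
  else tscale (fine (tlen T v w))^-1 (tpos T w - tpos T v).

Definition is_lab_trop_curve : Prop :=
  [/\ is_abstract_trop_curve,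
      injective (tfoot T) /\
        (forall v : V, is_foot v <-> exists l, v = tfoot T l),
      forall v w : V, ~~ is_foot v -> tadj T v w -> in_lattice (direction v w),
      forall v : V, ~~ is_foot v -> \sum_(w | tadj T v w) direction v w = 0
    & (forall i j, tleg T (tfoot T (inr (i, j))) = svec R i) /\
      (forall i, tleg T (tfoot T (inl i)) = 0)].

(* the total length of the walk v :: p *)
Definition walk_length (v : V) (p : seq V) : \bar R :=
  (\sum_(e <- zip (v :: p) p) tlen T e.1 e.2)%E.

Definition vdist (v w : V) : \bar R :=
  ereal_inf [set walk_length v p | p in
              [set p : seq V | path (tadj T) v p /\ last v p = w]]%classic.

(* the inner vertex incident to the leg with label l *)
Definition leg_vertex (l : label I r d) : V :=
  odflt (tfoot T l) [pick v | tadj T (tfoot T l) v].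

Definition ldist (l m : label I r d) : R :=
  fine (vdist (leg_vertex l) (leg_vertex m)).

(* The map is constant on the leg of i. *)
Definition trop_ev (i : I) : trop_torus R r := tpos T (leg_vertex (inl i)).

Definition trop_point (i0 : I) :
    pair_space R (label I r d) * trop_torus R r :=
  (pclass [ffun p : dpairs (label I r d) => - ldist (val p).1 (val p).2 / 2],
   trop_ev i0).

End TropCurves.

Section Corresponding.
Variables (R : realType) (K : fieldType) (nu : K -> \bar R).
Variables (I : finType) (r d : nat) (i0 : I).
Local Notation L0 := (label I r d).
(* The standard form is p_l = (1 : a l) for l != i0, f(p_i0) = (c_0:...:c_r);
   the value of a at i0 is not used. *)
Variables (a : L0 -> K) (c : 'rV[K]_r.+1).

Definition Lset : {set L0} := [set~ inl i0].

Definition nuset (A : {set L0}) : \bar R :=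
  \big[Order.min/+oo%E]_(l in A) \big[Order.min/+oo%E]_(m in A) nu (a m - a l).

(* A <= B in the partial order that defines V *)
Definition nuprec (A B : {set L0}) : bool :=
  (A \subset B) && (nuset A == nuset B).

(* A is in V *)
Definition nuvertex (A : {set L0}) : bool :=
  [&& A != finset.set0, A \subset Lset
    & [forall B : {set L0}, (B \subset Lset) && nuprec A B ==> (B == A)]].

(* B covers A in V *)
Definition nucovers (B A : {set L0}) : bool :=
  [&& nuvertex A, nuvertex B, A \proper B
    & ~~ [exists C : {set L0}, [&& nuvertex C, A \proper C & C \proper B]]].

Definition cvert : finType :=
  {A : {set L0} | nuvertex A || (A == [set inl i0])}.

Fact cfoot0_subproof :
  nuvertex [set inl i0] || ([set inl i0] == [set inl i0] :> {set L0}).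
Proof. by rewrite eqxx orbT. Qed.

Definition cfoot0 : cvert := Sub [set inl i0] cfoot0_subproof.

(* [insubd] turns a subset into a vertex; it is only applied to Lset and to
   singletons, which are vertices, so that the default value plays no role. *)
Definition croot : cvert := insubd cfoot0 Lset.
Definition cfoot (l : L0) : cvert := insubd cfoot0 [set l].

Definition cadj (v w : cvert) : bool :=
  [|| nucovers (val v) (val w), nucovers (val w) (val v),
      (v == cfoot0) && (val w == Lset) | (w == cfoot0) && (val v == Lset)].

Definition clen (v w : cvert) : \bar R :=
  if (v == cfoot0) || (w == cfoot0) then +oo%E
  else if val v \subset val w then (nuset (val v) - nuset (val w))%E
  else (nuset (val w) - nuset (val v))%E.

(* s_A *)
Definition ssum (A : {set L0}) : trop_torus R r :=
  \sum_(i < r.+1) svec R i *+ #|[set j : 'I_d | inr (i, j) \in A]|.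

(* the vertices after L on the path from L to v *)
Definition root_path (v : cvert) : seq cvert :=
  xget [::] [set p : seq cvert |
     [/\ path cadj croot p, uniq (croot :: p) & last croot p = v]]%classic.

Definition cpos (v : cvert) : trop_torus R r :=
  \sum_(i < r.+1) tscale (fine (nu (c 0 i))) (svec R i)
  + \sum_(e <- zip (croot :: root_path v) (root_path v))
      tscale (fine (clen e.2 e.1)) (ssum (val e.2)).

Definition corresponding_trop : trop_data R I r d :=
  TropData cadj clen cfoot cpos (fun v => ssum (val v)).

End Corresponding.

Section Characters.
Variables (S : finType) (r : nat).
Implicit Type m : charlattice S r.

Lemma charlattice_pairP m (s : S) :
  \sum_(p : dpairs S)
    (val m).1 p * (((val p).1 == s)%:R + ((val p).2 == s)%:R) = 0.
Proof. by have /andP[/forallP/(_ s)/eqP] := valP m. Qed.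

Lemma charlattice_sumP m : \sum_i (val m).2 i = 0.
Proof. by have /andP[_ /eqP] := valP m. Qed.

Lemma sum_pair_Phi (R : realType) m (x : S -> R) :
  \sum_(p : dpairs S) ((val m).1 p)%:~R * Phi x p = 0.
Proof.
transitivity (\sum_(s : S) x s * (\sum_(p : dpairs S)
    (val m).1 p * (((val p).1 == s)%:R + ((val p).2 == s)%:R))%:~R).
  under [RHS]eq_bigr do rewrite raddf_sum mulr_sumr.
  rewrite exchange_big /=; apply: eq_bigr => p _.
  rewrite ffunE; under eq_bigr do rewrite intrM mulrCA rmorphD /= mulrDr.
  rewrite -mulr_sumr big_split /=; congr (_ * (_ + _)).
  - rewrite (bigD1 (val p).1) //= eqxx mulr1 big1 ?addr0 // => s ns.
    by rewrite eq_sym (negPf ns) mulr0.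
  - rewrite (bigD1 (val p).2) //= eqxx mulr1 big1 ?addr0 // => s ns.
    by rewrite eq_sym (negPf ns) mulr0.
by apply: big1 => s _; rewrite charlattice_pairP mulr0.
Qed.

Lemma monomial_pair (K : fieldType) m (t : S -> K) : (forall s, t s != 0) ->
  \prod_(p : dpairs S) (t (val p).1 * t (val p).2) ^ (val m).1 p = 1.
Proof.
move=> t0; pose w (s : S) (p : dpairs S) : int :=
  ((val p).1 == s)%:R + ((val p).2 == s)%:R.
transitivity (\prod_(s : S) t s ^ (\sum_(p : dpairs S) (val m).1 p * w s p)).
  have expsum (y : K) (F : dpairs S -> int) : y != 0 ->
      y ^ (\sum_p F p) = \prod_p y ^ F p.
    by move=> y0; apply: (big_morph _ _ (expr0z y)) => u v; rewrite expfzDr.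
  under [RHS]eq_bigr => s _ do rewrite expsum //.
  rewrite exchange_big /=; apply: eq_bigr => p _.
  have expprod (n : int) (F : S -> K) : (\prod_s F s) ^ n = \prod_s F s ^ n.
    by apply: (big_morph (fun y : K => y ^ n)) => [y z|];
      rewrite ?exp1rz // expfzMl.
  transitivity ((\prod_s t s ^ w s p) ^ (val m).1 p); last first.
    by rewrite expprod; apply: eq_bigr => s _; rewrite -exprz_exp exprzAC.
  congr (_ ^ _); rewrite /w.
  under eq_bigr => s _ do rewrite expfzDr //.
  rewrite big_split /=; congr (_ * _).
  - rewrite (bigD1 (val p).1) //= eqxx expr1z big1 ?mulr1 // => s ns.
    by rewrite eq_sym (negPf ns) expr0z.
  - rewrite (bigD1 (val p).2) //= eqxx expr1z big1 ?mulr1 // => s ns.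
    by rewrite eq_sym (negPf ns) expr0z.
by apply: big1 => s _; rewrite charlattice_pairP expr0z.
Qed.

Lemma char_eval_coords (K : fieldType) m (x : gm K (dpairs S))
    (P : ptorus K r) (v : 'rV[K]_r.+1) : has_coords (val P) v ->
  char_eval m (\pi_(pair_torus K S) x, P) =
    monomial (val m).1 (val x) * monomial (val m).2 (v 0).
Proof.
move=> /has_coordsP[t t0 ev]; rewrite /char_eval /=; congr (_ * _).
  have /eqmodP/asboolP[u eu] : repr (\pi_(pair_torus K S) x) = x
    %[mod pair_torus K S] by rewrite reprK.
  have u0 s : val u s != 0 by exact: (forallP (valP u)).
  rewrite /monomial; under [RHS]eq_bigr => p _ do rewrite eu expfzMl.
  by rewrite big_split /= monomial_pair // mul1r.
rewrite /monomial.
transitivity (\prod_i (t ^ (val m).2 i * hc (val P) 0 i ^ (val m).2 i)).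
  have e : t ^ (\sum_i (val m).2 i) = \prod_i t ^ (val m).2 i.
    by apply: (big_morph _ _ (expr0z t)) => y z; rewrite expfzDr.
  by rewrite big_split /= -e charlattice_sumP expr0z mul1r.
by apply: eq_bigr => i _; rewrite ev mxE expfzMl.
Qed.

Section Tropical.
Variable R : realType.

Lemma prepr_pclass (q : {ffun dpairs S -> R}) :
  exists x, prepr (pclass q) = q + Phi x.
Proof.
rewrite /prepr /pclass; set Q := Quotient.quot _.
have /eqP : repr (\pi_Q q) = q %[mod Q] by rewrite reprK.
rewrite -Quotient.idealrBE => /asboolP[x e].
by exists x; rewrite -e addrC subrK.
Qed.

Lemma pclass_eq (q q' : {ffun dpairs S -> R}) :
  pclass q = pclass q' <-> exists x, q = q' + Phi x.
Proof.
rewrite /pclass; set Q := Quotient.quot _; split=> [/eqP|[x ->]].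
  rewrite -Quotient.idealrBE => /asboolP[x e].
  by exists x; rewrite -e addrC subrK.
apply/eqP; rewrite -Quotient.idealrBE; apply/asboolP; exists x.
by rewrite addrC addKr.
Qed.

Lemma preprK (u : pair_space R S) : pclass (prepr u) = u.
Proof. exact: reprK. Qed.

Lemma trepr_tclass (v : 'rV[R]_r.+1) :
  exists t, trepr (tclass v) = v + const_mx t.
Proof.
rewrite /trepr /tclass; set Q := Quotient.quot _.
have /eqP : repr (\pi_Q v) = v %[mod Q] by rewrite reprK.
rewrite -Quotient.idealrBE => /asboolP[t e].
by exists t; rewrite -e addrC subrK.
Qed.

Lemma tclass_eq (v v' : 'rV[R]_r.+1) :
  tclass v = tclass v' <-> exists t, v = v' + const_mx t.
Proof.
rewrite /tclass; set Q := Quotient.quot _; split=> [/eqP|[x ->]].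
  rewrite -Quotient.idealrBE => /asboolP[x e].
  by exists x; rewrite -e addrC subrK.
apply/eqP; rewrite -Quotient.idealrBE; apply/asboolP; exists x.
by rewrite addrC addKr.
Qed.

Lemma treprK (u : trop_torus R r) : tclass (trepr u) = u.
Proof. exact: reprK. Qed.

Lemma tclassD : {morph @tclass R r : u v / u + v}.
Proof. by move=> u v; exact: (raddfD (\pi_(Quotient.quot _))). Qed.

Lemma tclassN : {morph @tclass R r : u / - u}.
Proof. by move=> u; exact: (raddfN (\pi_(Quotient.quot _))). Qed.

Lemma tscale_tclass t (v : 'rV[R]_r.+1) : tscale t (tclass v) = tclass (t *: v).
Proof.
have [z e] := trepr_tclass v; apply/tclass_eq; exists (t * z); rewrite e.
by apply/rowP => k; rewrite !mxE mulrDr.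
Qed.

Lemma trop_ident_class m q v :
  trop_ident (pclass q, tclass v) m =
    \sum_(p : dpairs S) ((val m).1 p)%:~R * q p
    + \sum_(i < r.+1) ((val m).2 i)%:~R * v 0 i :> R.
Proof.
rewrite /trop_ident /=; have [x ->] := prepr_pclass q.
have [t ->] := trepr_tclass v; congr (_ + _).
  under eq_bigr => p _ do rewrite ffunE mulrDr.
  by rewrite big_split /= sum_pair_Phi addr0.
under eq_bigr => p _ do rewrite !mxE mulrDr.
rewrite big_split /= -mulr_suml -raddf_sum /=.
by rewrite charlattice_sumP mul0r addr0.
Qed.

Lemma ann_pairs (u : dpairs S -> R) :
  (forall m, \sum_(p : dpairs S) ((val m).1 p)%:~R * u p = 0) ->
  forall p1 p2 p3 p4 : dpairs S,
  (forall s, ((val p1).1 == s) + ((val p1).2 == s)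
             + (((val p2).1 == s) + ((val p2).2 == s)) =
             ((val p3).1 == s) + ((val p3).2 == s)
             + (((val p4).1 == s) + ((val p4).2 == s)))%N ->
  u p1 + u p2 = u p3 + u p4.
Proof.
move=> h p1 p2 p3 p4 hw.
pose D (p0 p : dpairs S) : int := (p == p0)%:R.
pose f : {ffun dpairs S -> int} := [ffun p => D p1 p + D p2 p - D p3 p - D p4 p].
have sumD (A : pzRingType) p0 (w : dpairs S -> A) :
    \sum_p (D p0 p)%:~R * w p = w p0.
  rewrite (bigD1 p0) //= /D eqxx mul1r big1 ?addr0 // => p np.
  by rewrite (negPf np) mul0r.
have sumf (A : pzRingType) (w : dpairs S -> A) :
    \sum_p (f p)%:~R * w p = w p1 + w p2 - w p3 - w p4.
  rewrite -(sumD _ p1) -(sumD _ p2) -(sumD _ p3) -(sumD _ p4).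
  rewrite -big_split -!sumrB; apply: eq_bigr => p _ /=.
  by rewrite ffunE !raddfB raddfD /= !mulrBl mulrDl.
have chf : is_character (f, [ffun _ : 'I_r.+1 => 0 : int]).
  apply/andP; split=> /=; last first.
    by apply/eqP; apply: big1 => i _; rewrite ffunE.
  apply/forallP => s; apply/eqP.
  pose w (p : dpairs S) : int := ((val p).1 == s)%:R + ((val p).2 == s)%:R.
  transitivity (\sum_p (f p)%:~R * w p).
    by apply: eq_bigr => p _; rewrite intz.
  by rewrite sumf /w -!natrD hw !natrD -addrA -opprD subrr.
have := h (exist _ (f, [ffun _ : 'I_r.+1 => 0 : int]) chf); rewrite /= sumf => e.
by apply/eqP; rewrite -subr_eq0 opprD addrA e.
Qed.

Lemma ann_imPhi (u : {ffun dpairs S -> R}) : (3 <= #|S|)%N ->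
  (forall m, \sum_(p : dpairs S) ((val m).1 p)%:~R * u p = 0) ->
  exists x, u = Phi x.
Proof.
move=> S3 /ann_pairs ann.
pose U a b : R := if insub (a, b) is Some p then u p else 0.
have UE (p : dpairs S) : U (val p).1 (val p).2 = u p.
  by rewrite /U -surjective_pairing valK.
have Usym a b : a != b -> U a b = U b a.
  move=> nab; have nba : b != a by rewrite eq_sym.
  pose p : dpairs S := exist _ (a, b) nab; pose q : dpairs S := exist _ (b, a) nba.
  have := ann p q q q; rewrite -(UE p) -(UE q) /= => e.
  apply/(addIr (U b a))/e => s.
  by rewrite [in LHS]addnC; congr (_ + _)%N; rewrite [LHS]addnC.
have U4 a b c e : a != b -> c != e -> a != e -> c != b ->
    U a b + U c e = U a e + U c b.
  move=> h1 h2 h3 h4.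
  pose p1 : dpairs S := exist _ (a, b) h1; pose p2 : dpairs S := exist _ (c, e) h2.
  pose p3 : dpairs S := exist _ (a, e) h3; pose p4 : dpairs S := exist _ (c, b) h4.
  have := ann p1 p2 p3 p4; rewrite -(UE p1) -(UE p2) -(UE p3) -(UE p4) /=; apply.
  by move=> s; lia.
pose X s k l := (U s k + U s l - U k l) / 2.
pose ok (s k l : S) := [&& s != k, s != l & k != l].
have Xsym s k l : k != l -> X s k l = X s l k.
  by move=> h; rewrite /X (Usym k l) // [U s k + _]addrC.
have X1 s k l l' : ok s k l -> ok s k l' -> X s k l = X s k l'.
  move=> /and3P[h1 h2 h3] /and3P[_ h5 h6]; rewrite /X; congr (_ / 2).
  by have := U4 s l k l' h2 h6 h5 h3; lra.
have Xind s k l k' l' : ok s k l -> ok s k' l' -> X s k l = X s k' l'.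
  move=> o1 o2; have /and3P[a1 a2 a3] := o1; have /and3P[b1 b2 b3] := o2.
  have [e|ne] := eqVneq k l'.
    subst l'; rewrite (Xsym s k' k) //; apply: X1 => //.
    by rewrite /ok a1 b1 eq_sym.
  rewrite (X1 s k l l') //; last by rewrite /ok a1 b2.
  rewrite (Xsym s k l') // (Xsym s k' l') //; apply: X1.
    by rewrite /ok a1 b2 eq_sym.
  by rewrite /ok b1 b2 eq_sym.
have third s t : exists k : S, (k != s) && (k != t).
  have /card_gt0P[k] : (0 < #|~: [set s; t]|)%N.
    have := cardsC [set s; t]; have : (#|[set s; t]| <= 2)%N by rewrite cards2; case: eqP.
    by lia.
  by rewrite !inE negb_or => kk; exists k.
have ex s : exists kl : S * S, ok s kl.1 kl.2.
  have [k /andP[k1 _]] := third s s; have [l /andP[l1 l2]] := third s k.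
  by exists (k, l); rewrite /ok /= eq_sym k1 eq_sym l1 eq_sym l2.
pose c s := xchoose (ex s).
exists (fun s => X s (c s).1 (c s).2); apply/ffunP => p.
rewrite ffunE -UE; case: p => -[a b] /= nab.
have [k /andP[ka kb]] := third a b.
have nba : b != a by rewrite eq_sym.
have ak : a != k by rewrite eq_sym.
have bk : b != k by rewrite eq_sym.
rewrite (Xind a _ _ b k (xchooseP (ex a))); last by rewrite /ok nab ak bk.
rewrite (Xind b _ _ a k (xchooseP (ex b))); last by rewrite /ok nba ak bk.
by rewrite /X (Usym b a) //; lra.
Qed.

Lemma trop_ident_inj : (3 <= #|S|)%N ->
  injective (@trop_ident R S r).
Proof.
move=> S3 [q1 e1] [q2 e2]; rewrite -(preprK q1) -(preprK q2).
rewrite -(treprK e1) -(treprK e2).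
move: (prepr q1) (prepr q2) (trepr e1) (trepr e2) => {}q1 {}q2 {}e1 {}e2 h.
have hm m : \sum_(p : dpairs S) ((val m).1 p)%:~R * (q1 - q2) p
    + \sum_(i < r.+1) ((val m).2 i)%:~R * (e1 - e2) 0 i = 0 :> R.
  have := congr1 (fun f => f m) h; rewrite !trop_ident_class => /eqP.
  rewrite -subr_eq0 opprD addrACA -!sumrB => /eqP e; rewrite -[RHS]e.
  by congr (_ + _); apply: eq_bigr => k _; rewrite !(ffunE, mxE) mulrBr.
congr (_, _).
  apply/pclass_eq; have [//|x ex] := @ann_imPhi (q1 - q2) S3.
    move=> m.
    have chf : is_character ((val m).1, [ffun _ : 'I_r.+1 => 0 : int]).
      have /andP[h1 _] := valP m; apply/andP; split=> //=.
      by apply/eqP; apply: big1 => i _; rewrite ffunE.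
    have := hm (exist (@is_character S r) _ chf); rewrite /= [X in _ + X]big1 ?addr0 // => i _.
    by rewrite ffunE mul0r.
  by exists x; rewrite -ex addrC subrK.
apply/tclass_eq; exists ((e1 - e2) 0 0); apply/rowP => i; rewrite mxE [const_mx _ _ _]mxE.
pose n : {ffun 'I_r.+1 -> int} := [ffun k => (k == i)%:R - (k == 0)%:R].
have sumn (A : pzRingType) (w : 'I_r.+1 -> A) :
    \sum_k (n k)%:~R * w k = w i - w 0.
  have s1 (j : 'I_r.+1) : \sum_k ((k == j)%:R : int)%:~R * w k = w j.
    rewrite (bigD1 j) //= eqxx mul1r big1 ?addr0 // => k nk.
    by rewrite (negPf nk) mul0r.
  rewrite -(s1 i) -(s1 0) -sumrB; apply: eq_bigr => k _.
  by rewrite ffunE raddfB mulrBl.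
have chf : is_character ([ffun _ : dpairs S => 0 : int], n).
  apply/andP; split=> /=.
    by apply/forallP => s; apply/eqP; apply: big1 => p _; rewrite ffunE mul0r.
  have e := sumn int (fun=> 1); rewrite subrr in e; rewrite -[X in _ == X]e.
  by apply/eqP; apply: eq_bigr => k _; rewrite mulr1 intz.
have := hm (exist (@is_character S r) _ chf); rewrite /= [X in X + _]big1 ?add0r; last first.
  by move=> p _; rewrite ffunE mul0r.
rewrite sumn => /eqP; rewrite subr_eq0 => /eqP <-.
by rewrite !mxE addrC subrK.
Qed.

End Tropical.
End Characters.

(* Main.v *)
(* Closed balls of the ultrametric nu (a m - a l) form a laminar family, so the
   vertices of the corresponding curve, with the foot of i0 hung below L, form a
   tree rooted at L: the parent of v is the smallest ball properly containing v.
   The edge from v to its parent has length nu(v) - nu(parent), and its direction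
   is s_v; as the children of v partition v, and as the s_i sum to 0, the curve is
   balanced.

   The distance of inner vertices v and w is nu(v) + nu(w) - 2 nu(v u w): it is
   realized by climbing to the hull of v u w and down again, and it is 1-Lipschitz
   in v along every edge, so no walk is shorter.  For the inner vertices on the
   legs of l, m != i0 the join has value nu (a m - a l), hence -dist/2 agrees with
   the valuations of the brackets up to the image of Phi. *)
Require Import Defs.
From mathcomp Require Import all_boot all_order all_algebra.
From mathcomp Require Import constructive_ereal reals.
From mathcomp Require Import zify ring lra.
From mathcomp Require boolp classical_sets ereal.

Set Implicit Arguments.
Unset Strict Implicit.
Unset Printing Implicit Defensive.

Import Order.TTheory GRing.Theory Num.Theory.

(** Used to split off the last edge of a root path in the sum that defines [cpos]. *)
Lemma zip_cons_rcons (T : Type) (x y : T) (p : seq T) :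
  zip (x :: rcons p y) (rcons p y) = rcons (zip (x :: p) p) (last x p, y).
Proof. by elim: p x => //= z p IH x; rewrite [in LHS]IH. Qed.

(** * Finite trees given by a root and a parent map *)

Section RootedTree.
Variables (T : finType) (adj : rel T) (root : T) (par : T -> T) (rk : T -> nat).
Hypothesis adjE : forall x y,
  adj x y = (x != root) && (y == par x) || (y != root) && (x == par y).
Hypothesis rk_par : forall x, x != root -> rk x < rk (par x).

Lemma rooted_sym : symmetric adj.
Proof. by move=> x y; rewrite !adjE orbC. Qed.

Lemma rooted_irr : irreflexive adj.
Proof.
move=> x; rewrite adjE orbb; apply/negP => /andP[/rk_par + /eqP e].
by rewrite -e ltnn.
Qed.

Lemma rooted_adj_rk x y : adj x y -> rk x <= rk y -> y = par x.
Proof.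
rewrite adjE => /orP[/andP[_ /eqP //]|/andP[/rk_par + /eqP ->]].
by rewrite ltnNge => /negP.
Qed.

Lemma rooted_connect x y : connect adj x y.
Proof.
have csym := sym_connect_sym rooted_sym.
suff to_root z : connect adj z root.
  by apply: (connect_trans (to_root x)); rewrite csym.
(* Climbing to the parent shrinks the gap to the maximal rank. *)
have [n] := ubnP (\max_u rk u - rk z).
elim: n z => // n IH z lt_n; have [-> //|zr] := eqVneq z root.
apply: connect_trans (connect1 (_ : adj z (par z))) (IH _ _).
  by rewrite adjE zr eqxx.
have := rk_par zr; have := leq_bigmax (F := rk) (par z); lia.
Qed.

(** On a cycle, both neighbours of a vertex of least rank must be its parent; without repetitions
    the cycle then has at most two vertices. *)
Lemma rooted_acyclic p : ucycle adj p -> size p <= 2.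
Proof.
case: p => // x0 p0; set p := x0 :: p0 => pc.
have xp : [arg min_(y < x0 in p) rk y] \in p by case: arg_minnP => //; rewrite mem_head.
move: pc xp; case: arg_minnP => [|x]; first by rewrite mem_head.
move=> _ min_x pc xp; have [i q e] := rot_to xp.
rewrite -(size_rot i) e; move: pc; rewrite -(rot_ucycle i) e.
have {}min_x y : y \in x :: q -> rk x <= rk y by rewrite -e mem_rot; apply: min_x.
case: q e min_x => // y q _ min_x /andP[]; rewrite /= rcons_path => /and3P[xy _ zx].
have ey : y = par x by apply: rooted_adj_rk xy _; apply: min_x; rewrite !inE eqxx orbT.
have ez : last y q = par x.
  apply: rooted_adj_rk; first by rewrite rooted_sym.
  by apply: min_x; rewrite in_cons mem_last orbT.
case: q ey ez {zx min_x} => //= z q ey ez /and4P[_ + _ _].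
by rewrite ey -ez mem_last.
Qed.

(** A simple path from the root only moves away from it: a step from [y] to its parent would return
    to the predecessor of [y], which is that parent by induction. *)
Lemma rooted_path_par p x : path adj root (rcons p x) ->
  uniq (root :: rcons p x) -> last root p = par x.
Proof.
elim/last_ind: p x => [|p y IH] x.
  rewrite /= adjE eqxx /= andbT => /andP[xr /eqP ->] //.
rewrite rcons_path last_rcons => /andP[py yx].
rewrite -rcons_cons rcons_uniq => /andP[xp uy].
move: yx; rewrite adjE => /orP[/andP[_ /eqP ex]|/andP[_ /eqP //]].
move: xp; rewrite ex -(IH y py uy) -rcons_cons mem_rcons inE negb_or.
by rewrite mem_last andbF.
Qed.

(** The condition by which [root_path] is chosen; [root_uniq_path_uniq] shows that it leaves no
    choice. *)
Definition root_uniq_path x p := [/\ path adj root p, uniq (root :: p) & last root p = x].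

Lemma root_uniq_path_rcons x p : x != root -> root_uniq_path x p ->
  exists2 q, p = rcons q x & root_uniq_path (par x) q.
Proof.
move=> xr [pp up lp]; case/lastP: p => [|q y] in pp up lp *.
  by move: xr; rewrite -lp eqxx.
move: lp; rewrite last_rcons => ey; subst y; exists q => //; split.
- by move: pp; rewrite rcons_path => /andP[].
- by move: up; rewrite -rcons_cons rcons_uniq => /andP[].
- exact: rooted_path_par.
Qed.

(** Removing the last vertex of either path leaves such a path to [par x], so induction applies. *)
Lemma root_uniq_path_uniq x p q :
  root_uniq_path x p -> root_uniq_path x q -> p = q.
Proof.
have nilP s : root_uniq_path root s -> s = [::].
  case/lastP: s => // s y [_ + ls]; rewrite last_rcons in ls.
  by rewrite ls /= mem_rcons mem_head.
have [n] := ubnP (size p); elim: n x p q => // n IH x p q lt_n.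
have [->|xr] := eqVneq x root; first by move=> /nilP -> /nilP ->.
move=> /(root_uniq_path_rcons xr)[p' ep hp].
move=> /(root_uniq_path_rcons xr)[q' -> hq].
by rewrite ep (IH _ p' q' _ hp hq) //; move: lt_n; rewrite ep size_rcons.
Qed.

Lemma root_uniq_path_exists x : exists p, root_uniq_path x p.
Proof.
have /connectP[p pp ex] := rooted_connect root x.
case: (shortenP pp) ex => q pq uq _ ex.
by exists q.
Qed.

End RootedTree.

(** * Scaling, sums and the lattice in the tropical torus *)

Section TropTorus.
Local Open Scope ring_scope.
Variables (R : realType) (r : nat).
Implicit Types (u v : trop_torus R r) (t s : R).

Lemma tscaleA s t u : tscale s (tscale t u) = tscale (s * t) u.
Proof. by rewrite -(treprK u) !tscale_tclass scalerA. Qed.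

Lemma tscale1 u : tscale 1 u = u.
Proof. by rewrite -(treprK u) tscale_tclass scale1r. Qed.

Lemma tscaleN t u : tscale t (- u) = - tscale t u.
Proof. by rewrite -(treprK u) -tclassN !tscale_tclass scalerN tclassN. Qed.

Lemma tclass0 : tclass (0 : 'rV[R]_r.+1) = 0.
Proof. by apply: (addrI (tclass 0)); rewrite -tclassD !addr0. Qed.

Lemma tclass_sum (J : finType) (F : J -> 'rV[R]_r.+1) :
  tclass (\sum_j F j) = \sum_j tclass (F j).
Proof. exact: (big_morph _ (@tclassD _ _) tclass0). Qed.

Lemma sum_svec : \sum_i svec R i = 0 :> trop_torus R r.
Proof.
(* The standard basis vectors sum to the constant vector 1. *)
rewrite -tclass_sum -tclass0; apply/tclass_eq; exists 1; rewrite add0r.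
apply/rowP => j; rewrite summxE (bigD1 j) //= big1 ?addr0 => [|i ij];
  by rewrite !mxE eqxx ?[j == i]eq_sym ?(negPf ij) ?eqxx.
Qed.

Lemma in_lattice0 : in_lattice (0 : trop_torus R r).
Proof. by exists 0; rewrite raddf0 tclass0. Qed.

Lemma in_latticeD u v : in_lattice u -> in_lattice v -> in_lattice (u + v).
Proof. by move=> [x ->] [y ->]; exists (x + y); rewrite raddfD tclassD. Qed.

Lemma in_latticeN u : in_lattice u -> in_lattice (- u).
Proof. by move=> [x ->]; exists (- x); rewrite raddfN tclassN. Qed.

Lemma in_lattice_svec i : in_lattice (svec R i : trop_torus R r).
Proof.
by exists (delta_mx 0 i); congr tclass; apply/rowP => j; rewrite !mxE natz.
Qed.

End TropTorus.

(** * The vectors s_A as sums over labels *)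

Section LabelSum.
Local Open Scope ring_scope.
Variables (R : realType) (I : finType) (r d : nat).
Implicit Type A : {set label I r d}.

Definition label_direction (l : label I r d) : trop_torus R r :=
  if l is inr (i, _) then svec R i else 0.

(** In this form s_A is visibly additive over partitions of [A], which is what balancing uses. *)
Lemma ssumE A : ssum R A = \sum_(l in A) label_direction l.
Proof.
rewrite big_mkcond big_sumType /= big1 ?add0r => [|i _]; last by case: ifP.
rewrite (eq_bigr (fun p => (fun i j => if inr (i, j) \in A then svec R i else 0)
  p.1 p.2)) => [|[] //].
rewrite -(pair_bigA _ (fun i j => if inr (i, j) \in A then svec R i else 0)) /=.
apply: eq_bigr => i _; rewrite -big_mkcond /= sumr_const; congr (_ *+ _).
by apply: eq_card => j; rewrite inE.
Qed.

Lemma ssum1 l : ssum R [set l] = label_direction l.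
Proof. by rewrite ssumE big_set1. Qed.

Lemma ssum_lattice A : in_lattice (ssum R A).
Proof.
rewrite ssumE; apply: (big_ind (@in_lattice R r)) => [|u v|l _].
- exact: in_lattice0.
- exact: in_latticeD.
by case: l => [i|[i j]]; [exact: in_lattice0 | exact: in_lattice_svec].
Qed.

(** The only label missing from [Lset] lies in I, so each s_i occurs d times, and the s_i sum to
    0. *)
Lemma ssum_Lset (i0 : I) : ssum R (Lset r d i0) = 0.
Proof.
rewrite /ssum -[RHS](mul0rn _ d) -[X in X *+ d]sum_svec -sumrMnl.
apply: eq_bigr => i _; congr (_ *+ _); rewrite -[RHS]card_ord.
by apply: eq_card => j; rewrite !inE.
Qed.

End LabelSum.

(** * Walks and distances in a metric graph *)

Section Walks.
Variables (R : realType) (I : finType) (r d : nat) (T : trop_data R I r d).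

Lemma walk_length_cons v w (p : seq (tvert T)) :
  walk_length v (w :: p) = (tlen T v w + walk_length w p)%E.
Proof. by rewrite /walk_length /= big_cons. Qed.

Lemma walk_length_nil (v : tvert T) : walk_length v [::] = 0%E.
Proof. exact: big_nil. Qed.

Lemma walk_length_cat v (p q : seq (tvert T)) :
  walk_length v (p ++ q) = (walk_length v p + walk_length (last v p) q)%E.
Proof.
elim: p v => [|w p IH] v; first by rewrite walk_length_nil add0e.
by rewrite cat_cons !walk_length_cons IH addeA.
Qed.

(** As [x] is real, only walks of finite length are meant; they bound distances from above. *)
Definition has_walk v w (x : R) := exists p : seq (tvert T),
  [/\ path (tadj T) v p, last v p = w & walk_length v p = x%:E].

Lemma has_walk_refl v : has_walk v v 0%R.
Proof. by exists [::]; rewrite walk_length_nil. Qed.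

Lemma has_walk_edge v w x : tadj T v w -> tlen T v w = x%:E -> has_walk v w x.
Proof.
move=> vw e; exists [:: w]; split=> //=; first by rewrite vw.
by rewrite walk_length_cons walk_length_nil adde0.
Qed.

Lemma has_walk_trans u v w x y :
  has_walk u v x -> has_walk v w y -> has_walk u w (x + y)%R.
Proof.
move=> [p [pp lp wp]] [q [pq lq wq]]; exists (p ++ q).
by rewrite cat_path pp lp last_cat lp walk_length_cat lp wp wq.
Qed.

Lemma vdist_eq v w x : has_walk v w x ->
  (forall p, path (tadj T) v p -> last v p = w -> (x%:E <= walk_length v p)%E) ->
  vdist v w = x%:E.
Proof.
move=> [p [pp lp wp]] h; apply/le_anti/andP; split.
  by apply: ereal.ge_ereal_inf; exists x%:E => //; exists p.
by apply: ereal.le_ereal_inf_tmp => _ [q [pq lq] <-]; apply: h.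
Qed.

End Walks.

(** * Valuations of products and monomials *)

Section Valuation.
Local Open Scope ring_scope.
Variables (R : realType) (K : fieldType) (nu : K -> \bar R).
Hypothesis hnu : valuation nu.

Lemma valuation0 : nu 0 = +oo%E.
Proof. by have [_ h _ _] := hnu; apply/h. Qed.

Lemma valuation_fin x : x != 0 -> nu x \is a fin_num.
Proof.
have [hN h0 _ _] := hnu => x0; rewrite fin_numE hN /=.
by apply: contra_neq x0 => /h0.
Qed.

Lemma valuation_fineE x : x != 0 -> nu x = (fine (nu x))%:E.
Proof. by move=> x0; rewrite fineK ?valuation_fin. Qed.

Lemma fine_valuationM x y : x != 0 -> y != 0 ->
  fine (nu (x * y)) = fine (nu x) + fine (nu y).
Proof.
by have [_ _ hM _] := hnu => x0 y0; rewrite hM fineD ?valuation_fin.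
Qed.

Lemma fine_valuation1 : fine (nu 1) = 0.
Proof.
have := fine_valuationM (oner_neq0 K) (oner_neq0 K); rewrite mulr1 => e.
by apply: (addrI (fine (nu 1))); rewrite -e addr0.
Qed.

Lemma valuationN x : nu (- x) = nu x.
Proof.
have [-> |x0] := eqVneq x 0; first by rewrite oppr0.
have N1 : (-1 : K) != 0 by rewrite oppr_eq0 oner_neq0.
(* The square of -1 is 1, so twice its valuation is 0. *)
have vN1 : fine (nu (-1)) = 0.
  by have := fine_valuationM N1 N1; rewrite mulN1r opprK fine_valuation1; lra.
rewrite -mulN1r valuation_fineE ?mulf_neq0 // fine_valuationM //.
by rewrite vN1 add0r -valuation_fineE.
Qed.

Lemma fine_valuationXn x n : x != 0 -> fine (nu (x ^+ n)) = fine (nu x) *+ n.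
Proof.
move=> x0; elim: n => [|n IH]; first by rewrite expr0 fine_valuation1.
by rewrite exprS fine_valuationM ?expf_neq0 // IH mulrS.
Qed.

Lemma fine_valuationV x : x != 0 -> fine (nu x^-1) = - fine (nu x).
Proof.
move=> x0; apply/eqP; rewrite -addr_eq0 -fine_valuationM ?invr_eq0 //.
by rewrite mulVf // fine_valuation1.
Qed.

Lemma fine_valuationXz x (n : int) : x != 0 ->
  fine (nu (x ^ n)) = n%:~R * fine (nu x).
Proof.
move=> x0; case: n => n; first by rewrite -exprnP fine_valuationXn // mulr_natl.
(* The remaining exponent is [Negz n], which stands for -(n+1). *)
rewrite -[x ^ _]/(x ^+ n.+1)^-1 fine_valuationV ?expf_neq0 // fine_valuationXn //.
by rewrite NegzE mulrNz mulNr mulr_natl.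
Qed.

Lemma fine_valuation_prod (T : finType) (F : T -> K) : (forall t, F t != 0) ->
  fine (nu (\prod_t F t)) = \sum_t fine (nu (F t)).
Proof.
move=> F0; apply: (big_rec2 (fun x y => x != 0 /\ fine (nu x) = y) _ _).2.
  by rewrite oner_neq0 fine_valuation1.
by move=> t x y _ [x0 <-]; rewrite mulf_neq0 ?F0 // fine_valuationM.
Qed.

Lemma fine_valuation_monomial (T : finType) (m : {ffun T -> int}) (x : T -> K) :
  (forall t, x t != 0) ->
  fine (nu (monomial m x)) = \sum_t (m t)%:~R * fine (nu (x t)).
Proof.
move=> x0; rewrite fine_valuation_prod => [|t]; last by rewrite expfz_neq0.
by apply: eq_bigr => t _; rewrite fine_valuationXz.
Qed.

Lemma monomial_neq0 (T : finType) (m : {ffun T -> int}) (x : T -> K) :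
  (forall t, x t != 0) -> monomial m x != 0.
Proof. by move=> x0; apply/prodf_neq0 => t _; rewrite expfz_neq0. Qed.

End Valuation.

(** * Closed balls of the ultrametric on the labels *)

Section Balls.
Local Open Scope ring_scope.
Variables (R : realType) (K : fieldType) (nu : K -> \bar R).
Variables (I : finType) (r d : nat) (i0 : I).
Local Notation L0 := (label I r d).
Variable a : L0 -> K.
Hypothesis hnu : valuation nu.
Hypothesis a_inj : {in [set~ inl i0] &, injective a}.
Implicit Types (A B : {set L0}) (l m : L0).

Local Notation L := (Lset r d i0).
Local Notation nuset := (nuset nu a).
Local Notation nuvertex := (nuvertex nu i0 a).

Lemma nusetP (x : \bar R) A :
  reflect (forall l m, l \in A -> m \in A -> (x <= nu (a m - a l)%R)%E)
          (x <= nuset A)%E.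
Proof.
apply: (iffP (bigmin_geP _ _ _ _)) => [[_ h] l m lA mA|h].
  by have /bigmin_geP[_] := h l lA; apply.
split=> [|l lA]; first by rewrite leey.
by apply/bigmin_geP; split=> [|m mA]; rewrite ?leey ?h.
Qed.

Lemma nuset_le A l m : l \in A -> m \in A -> (nuset A <= nu (a m - a l)%R)%E.
Proof. by move=> lA mA; have /nusetP := lexx (nuset A); apply. Qed.

Lemma nusetS A B : A \subset B -> (nuset B <= nuset A)%E.
Proof.
by move=> /subsetP AB; apply/nusetP => l m /AB lB /AB mB; apply: nuset_le.
Qed.

Lemma nuset2 l m : nuset [set l; m] = nu (a m - a l).
Proof.
apply/le_anti/andP; split; first by rewrite nuset_le ?set21 ?set22.
apply/nusetP => x y; rewrite !inE => /orP[]/eqP-> /orP[]/eqP->;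
  rewrite ?subrr ?(valuation0 hnu) ?leey //.
by rewrite -[in leRHS]opprB valuationN.
Qed.

Lemma nuset1 l : nuset [set l] = +oo%E.
Proof. by rewrite -[[set l]]setUid nuset2 subrr valuation0. Qed.

(** A difference across the two sets is split at the common label [l], and the ultrametric
    inequality applies. *)
Lemma nuset_setU A B l : l \in A -> l \in B ->
  (Order.min (nuset A) (nuset B) <= nuset (A :|: B))%E.
Proof.
move=> lA lB; apply/nusetP => x y; have [_ _ _ hD] := hnu.
have across (C D : {set L0}) u v : l \in C -> l \in D -> u \in C -> v \in D ->
    (Order.min (nuset C) (nuset D) <= nu (a v - a u)%R)%E.
  move=> lC lD uC vD; rewrite -(subrK (a l) (a v)) -addrA.
  apply: le_trans (hD _ _); rewrite le_min !ge_min.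
  by rewrite (nuset_le lD vD) (nuset_le uC lC) orbT.
rewrite !inE => /orP[] hx /orP[] hy.
- by rewrite ge_min nuset_le.
- exact: across.
- by rewrite minC; apply: across.
- by rewrite ge_min orbC nuset_le.
Qed.

Lemma nuset_gtNy A : (-oo < nuset A)%E.
Proof.
have [hN _ _ _] := hnu.
apply/bigmin_gtP; split=> // l _; apply/bigmin_gtP; split=> // m _.
by rewrite lt_neqAle eq_sym hN leNye.
Qed.

Lemma nuset_fin A : A \subset L -> (1 < #|A|)%N -> nuset A \is a fin_num.
Proof.
move=> /subsetP AL /card_gt1P[l [m [lA mA lm]]].
rewrite fin_numE -ltNye nuset_gtNy -ltey /=.
apply: le_lt_trans (nuset_le lA mA) _.
rewrite ltey_eq valuation_fin // subr_eq0.
by apply: contra_neq lm => e; apply/esym/a_inj => //; apply: AL.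
Qed.

Lemma nuvertexP A :
  reflect [/\ A != finset.set0, A \subset L & forall B, B \subset L -> A \subset B ->
             nuset A = nuset B -> B = A]
          (nuvertex A).
Proof.
apply: (iffP and3P) => -[A0 AL h]; split=> //.
  move=> B BL AB e; apply/eqP; apply: (implyP (forallP h B)).
  by rewrite BL /nuprec AB e eqxx.
by apply/forallP => B; apply/implyP => /and3P[BL AB /eqP e]; apply/eqP/h.
Qed.

Lemma nuvertex_sub A : nuvertex A -> A \subset L.
Proof. by case/nuvertexP. Qed.

Lemma nuvertex_neq0 A : nuvertex A -> A != finset.set0.
Proof. by case/nuvertexP. Qed.

(** By maximality of [A], a proper enlargement cannot keep the same value. *)
Lemma nuvertex_lt A B : nuvertex A -> B \subset L -> A \proper B ->
  (nuset B < nuset A)%E.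
Proof.
move=> /nuvertexP[_ _ hA] BL /properP[AB [x xB xA]].
rewrite lt_neqAle nusetS // andbT; apply: contraNneq xA => e.
by rewrite -(hA B).
Qed.

(** If [B] has the smaller value, the union has the same value as [B] because the two sets meet;
    maximality of [B] then makes the union equal to [B]. *)
Lemma nuvertex_laminar A B l : nuvertex A -> nuvertex B -> l \in A -> l \in B ->
  (A \subset B) || (B \subset A).
Proof.
wlog le : A B / (nuset B <= nuset A)%E => [hw|] vA vB lA lB.
  by have [le|/ltW le] := leP (nuset B) (nuset A); [|rewrite orbC]; apply: hw.
have [_ AL _] := nuvertexP _ vA; have [_ BL hB] := nuvertexP _ vB.
rewrite -(hB (A :|: B)) ?subsetUl ?subsetUr ?subUset ?AL //.
apply/le_anti; rewrite [in X in _ && X]nusetS ?subsetUr // andbT.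
by apply: le_trans (nuset_setU lA lB); rewrite le_min le lexx.
Qed.

(** A maximal set among the subsets of L that contain [A] and have its value is a vertex, since any
    enlargement of it with the same value is again such a set. *)
Lemma nuvertex_hull A : A != finset.set0 -> A \subset L ->
  exists B, [/\ nuvertex B, A \subset B & nuset B = nuset A].
Proof.
move=> A0 AL; pose P B := (B \subset L) && nuprec nu a A B.
have PA : P A by rewrite /P AL /nuprec subxx eqxx.
have [B /maxsetP[/and3P[BL AB /eqP eAB] maxB] _] := maxset_exists PA.
exists B; split=> //; apply/nuvertexP; split=> //.
  by apply: contra_neq A0 => B0; apply/eqP; rewrite -finset.subset0 -B0.
move=> C CL BC e; apply: maxB => //.
by rewrite /P CL /nuprec (subset_trans AB BC) -e eAB eqxx.
Qed.

(** A subset of L with two elements has finite value, so nothing larger than a singleton has value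
    [+oo]. *)
Lemma nuvertex1 l : l \in L -> nuvertex [set l].
Proof.
move=> lL; apply/nuvertexP; split; rewrite ?sub1set //.
  by apply/set0Pn; exists l; rewrite set11.
move=> B BL; rewrite sub1set nuset1 => lB e.
apply/esym/eqP; rewrite eqEcard sub1set lB cards1 leqNgt /=.
by apply/negP => /(nuset_fin BL); rewrite -e.
Qed.


(** * The balls form a tree rooted at L *)

Local Notation V := (cvert nu i0 a).
Local Notation croot := (croot nu i0 a).
Local Notation cfoot0 := (cfoot0 nu i0 a).
Local Notation cfoot := (cfoot nu i0 a).
Local Notation cadj := (@cadj R K nu I r d i0 a).
Hypothesis L_gt1 : (1 < #|L|)%N.
Implicit Types (u v w : V).

Lemma nuvertex_Lset : nuvertex L.
Proof.
apply/nuvertexP; split=> // [|B BL LB _].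
  by rewrite -card_gt0 (ltn_trans _ L_gt1).
by apply/eqP; rewrite finset.eqEsubset BL.
Qed.

Lemma val_croot : val croot = L.
Proof. by rewrite /Defs.croot val_insubd nuvertex_Lset. Qed.

Lemma val_cfoot l : val (cfoot l) = [set l].
Proof.
rewrite /Defs.cfoot val_insubd; case: eqVneq => [->|li0]; first by rewrite orbT.
by rewrite nuvertex1 // !inE; apply: contraNneq li0 => ->.
Qed.

(* Without this, closing goals by unification unfolds [insubd] at great cost. *)
Local Opaque Defs.croot Defs.cfoot.

Lemma cfootE : cfoot (inl i0) = cfoot0.
Proof. by apply/val_inj; rewrite val_cfoot. Qed.

Lemma nuvertex_inner v : nuvertex (val v) = (v != cfoot0).
Proof.
have [->|v0] := eqVneq v cfoot0; last first.
  by case/orP: (valP v) v0 => // /eqP e; rewrite -val_eqE /= e eqxx.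
apply/negP => /nuvertex_sub/subsetP/(_ (inl i0)).
by rewrite /= !inE eqxx => /(_ isT).
Qed.

Lemma croot_neq_cfoot0 : croot != cfoot0.
Proof. by rewrite -nuvertex_inner val_croot nuvertex_Lset. Qed.

Lemma nuvertex_val B : nuvertex B -> exists v, val v = B.
Proof.
move=> vB; have p : nuvertex B || (B == [set inl i0]) by rewrite vB.
by exists (exist _ B p).
Qed.

(* The foot of i0 hangs below the root, so that the whole tree is rooted at L. *)
Definition par v : V :=
  if v == cfoot0 then croot
  else [arg min_(w < croot | nuvertex (val w) && (val v \proper val w)) #|val w|].

Lemma croot_proper v : v != cfoot0 -> v != croot -> val v \proper val croot.
Proof.
rewrite -nuvertex_inner => vv vr; rewrite properEneq -(inj_eq val_inj) in vr *.
by rewrite vr val_croot nuvertex_sub.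
Qed.

(** The vertices properly containing [v] share a label, so by laminarity they form a chain, whose
    element of least cardinality lies in all the others. *)
Lemma par_spec v : v != cfoot0 -> v != croot ->
  [/\ nuvertex (val (par v)), val v \proper val (par v)
    & forall B, nuvertex B -> val v \proper B -> val (par v) \subset B].
Proof.
move=> v0 vr; rewrite /par (negPf v0); case: arg_minnP.
  by rewrite val_croot nuvertex_Lset -val_croot croot_proper.
move=> w /andP[nw vw] min_w; split=> // B nB vB.
have /set0Pn[l lv] : val v != finset.set0.
  by apply: nuvertex_neq0; rewrite nuvertex_inner.
have lw := subsetP (proper_sub vw) _ lv; have lB := subsetP (proper_sub vB) _ lv.
have /orP[//|Bw] := nuvertex_laminar nw nB lw lB.
have [u eu] := nuvertex_val nB.
have := min_w u; rewrite eu nB vB => /(_ isT) le.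
by rewrite (_ : B = val w) //; apply/eqP; rewrite eqEcard Bw.
Qed.

Lemma nuvertex_par v : v != croot -> nuvertex (val (par v)).
Proof.
have [-> _|v0 vr] := eqVneq v cfoot0; last by case: (par_spec v0 vr).
by rewrite /par eqxx val_croot nuvertex_Lset.
Qed.

Lemma card_par v : v != croot -> (1 < #|val (par v)|)%N.
Proof.
have [-> _|v0 vr] := eqVneq v cfoot0; first by rewrite /par eqxx val_croot.
have [_ /proper_card lt _] := par_spec v0 vr.
by apply: leq_ltn_trans lt; rewrite card_gt0 nuvertex_neq0 // nuvertex_inner.
Qed.

Lemma par_neq_cfoot0 v : v != croot -> par v != cfoot0.
Proof. by move/nuvertex_par; rewrite nuvertex_inner. Qed.

(** Minimality of the parent excludes vertices between it and [v]; for any other vertex above [v],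
    the parent lies strictly between. *)
Lemma nucoversE v w : nucovers nu i0 a (val w) (val v) =
  [&& v != cfoot0, v != croot & w == par v].
Proof.
rewrite /nucovers !nuvertex_inner; have [//|v0] := eqVneq v cfoot0.
have [->|vr] := eqVneq v croot.
  have [//|w0] := eqVneq w cfoot0.
  suff -> : val croot \proper val w = false by [].
  apply/negP => /andP[_ /negP[]]; rewrite val_croot nuvertex_sub //.
  by rewrite nuvertex_inner.
have [np vp min_p] := par_spec v0 vr.
have [->|wp] := eqVneq w (par v).
  rewrite -nuvertex_inner np vp /=; apply/negP => /existsP[B /and3P[nB vB]].
  by rewrite properE min_p // andbF.
apply/negP => /and4P[_ w0 vw /negP[]]; apply/existsP; exists (val (par v)).
rewrite np vp properEneq (inj_eq val_inj) eq_sym wp min_p //.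
by rewrite nuvertex_inner.
Qed.

(** This is the form of adjacency required of a rooted tree. The extra leg fits in because the
    parent of [cfoot0] is the root. *)
Lemma cadjE v w : cadj v w =
  (v != croot) && (w == par v) || (w != croot) && (v == par w).
Proof.
rewrite /Defs.cadj !nucoversE -!val_croot !(inj_eq val_inj).
have rF : (croot == cfoot0) = false by apply: negbTE; exact: croot_neq_cfoot0.
have Fr : (cfoot0 == croot) = false by rewrite eq_sym.
have parF : par cfoot0 = croot by rewrite /par eqxx.
have Fpar u : u != croot -> (cfoot0 == par u) = false.
  by move=> ur; rewrite eq_sym; apply: negbTE; exact: par_neq_cfoot0.
have [ev|v0] := eqVneq v cfoot0; have [ew|w0] := eqVneq w cfoot0; rewrite /=.
- by subst v w; rewrite Fr parF Fr.
- subst v; rewrite Fr parF /= orbF.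
  by have [->|/Fpar ->] := eqVneq w croot; rewrite ?orbF.
- subst w; rewrite Fr parF /=.
  by have [->|/Fpar ->] := eqVneq v croot; rewrite ?orbF.
- by rewrite orbF orbC.
Qed.

(** The rank for the rooted tree. The foot of i_0 is treated separately, as it is not contained in
    its parent. *)
Definition crank v : nat := if v == cfoot0 then 0%N else #|val v|.

Lemma crank_par v : v != croot -> (crank v < crank (par v))%N.
Proof.
move=> vr; rewrite /crank (negPf (par_neq_cfoot0 vr)).
case: eqVneq => [_|v0]; first exact: ltn_trans (card_par vr).
by case: (par_spec v0 vr) => _ /proper_card.
Qed.

Lemma nuset_par v : v != croot -> nuset (val (par v)) \is a fin_num.
Proof.
by move=> vr; rewrite nuset_fin ?card_par // nuvertex_sub // nuvertex_par.
Qed.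

(** One formula serves legs and bounded edges: a singleton, including the foot of i_0, has value
    [+oo], while the value of a parent is finite. *)
Lemma clen_par v : v != croot ->
  clen v (par v) = (nuset (val v) - nuset (val (par v)))%E /\
  clen (par v) v = (nuset (val v) - nuset (val (par v)))%E.
Proof.
move=> vr; rewrite /clen (negPf (par_neq_cfoot0 vr)) orbF /=.
case: eqVneq => [ev|v0].
  have -> : nuset (val v) = +oo%E by rewrite ev /= nuset1.
  by rewrite -(fineK (nuset_par vr)).
by have [_ /andP[-> /negPf->] _] := par_spec v0 vr.
Qed.

Lemma nuset_par_lt v : v != croot -> (nuset (val (par v)) < nuset (val v))%E.
Proof.
have [-> vr|v0 vr] := eqVneq v cfoot0.
  by rewrite [nuset (val cfoot0)]nuset1 ltey_eq nuset_par.
have [np vp _] := par_spec v0 vr.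
by apply: (nuvertex_lt _ _ vp); rewrite ?nuvertex_inner // (nuvertex_sub np).
Qed.

Lemma nuset_pinfty v : (nuset (val v) == +oo%E) = (#|val v| == 1%N).
Proof.
apply/idP/idP => [/eqP e|/cards1P[l ->]]; last by rewrite nuset1.
have [->|v0] := eqVneq v cfoot0; first by rewrite cards1.
have nv : nuvertex (val v) by rewrite nuvertex_inner.
rewrite eqn_leq card_gt0 nuvertex_neq0 // leqNgt andbT.
by apply/negP => /(nuset_fin (nuvertex_sub nv)); rewrite e.
Qed.

(** The child of [v] in the direction of [l]. The search starts at the foot of [l], a candidate
    whenever [v] is a ball containing [l] and a further label. *)
Definition cchild v l : V := [arg max_(w > cfoot l |
  [&& nuvertex (val w), l \in val w & val w \proper val v]) #|val w|].

(** If the parent of the chosen vertex were not [v], it would be a larger candidate. *)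
Lemma cchild_spec v l : nuvertex (val v) -> (1 < #|val v|)%N -> l \in val v ->
  [/\ cchild v l != cfoot0, cchild v l != croot, par (cchild v l) = v
    & l \in val (cchild v l)].
Proof.
move=> nv v1 lv; rewrite /cchild; case: arg_maxnP.
  have lL := subsetP (nuvertex_sub nv) _ lv.
  rewrite val_cfoot nuvertex1 // set11 properEcard sub1set lv cards1 //.
move=> w /and3P[nw lw wv] max_w; have w0 : w != cfoot0 by rewrite -nuvertex_inner.
have wr : w != croot.
  apply: contraTneq wv => ->; rewrite val_croot properE.
  by rewrite (nuvertex_sub nv) andbF.
split=> //; have [np wp min_p] := par_spec w0 wr.
apply/val_inj/eqP; apply: contraTT isT => pv.
have := max_w (par w); rewrite np (subsetP (proper_sub wp)) // properEneq pv.
rewrite min_p // => /(_ isT) le.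
by have := leq_trans (proper_card wp) le; rewrite ltnn.
Qed.

(** Two children of [v] that share a label are nested; a proper inclusion would place [v], the
    parent of the smaller one, inside the larger one. *)
Lemma cchild_uniq v w l : w != cfoot0 -> w != croot -> par w = v ->
  l \in val w -> w = cchild v l.
Proof.
move=> w0 wr ew lw; have nv : nuvertex (val v) by rewrite -ew nuvertex_par.
have [_ wv min_w] := par_spec w0 wr; rewrite ew in wv min_w.
have lv := subsetP (proper_sub wv) _ lw.
have [] := cchild_spec nv _ lv; first by rewrite -ew card_par.
move: (cchild v l) => c c0 cr ec lc.
have [_ cv min_c] := par_spec c0 cr; rewrite ec in cv min_c.
move: w0 c0; rewrite -!nuvertex_inner => nw nc; apply/val_inj/eqP.
have /orP[] := nuvertex_laminar nw nc lw lc; rewrite subEproper => /predU1P[->//|h].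
  by case/andP: cv => _ /negP[]; apply: min_w.
by case/andP: wv => _ /negP[]; apply: min_c.
Qed.

Lemma cfoot_inj : injective cfoot.
Proof. by move=> l m e; apply: finset.set1_inj; rewrite -!val_cfoot e. Qed.

Lemma cadj_sym : symmetric cadj. Proof. exact: rooted_sym cadjE. Qed.

Lemma cadj_par v : v != croot -> cadj v (par v).
Proof. by move=> vr; rewrite cadjE vr eqxx. Qed.

Lemma card_cvert_gt0 v : (0 < #|val v|)%N.
Proof.
have [->|v0] := eqVneq v cfoot0; first by rewrite cards1.
by rewrite card_gt0 nuvertex_neq0 // nuvertex_inner.
Qed.

Lemma card_inner v : #|val v| != 1%N -> (1 < #|val v|)%N.
Proof. by rewrite neq_ltn ltnNge card_cvert_gt0. Qed.

Lemma card_cfoot0 : #|val cfoot0| = 1%N.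
Proof. exact: cards1. Qed.

Lemma card_nuvertex v : #|val v| != 1%N -> nuvertex (val v).
Proof. by apply: contraNT; rewrite nuvertex_inner negbK => /eqP ->; rewrite card_cfoot0. Qed.

Lemma cfoot_root v : #|val v| = 1%N -> v != croot.
Proof. by move=> v1; apply: contraTneq L_gt1 => vr; rewrite -val_croot -vr v1. Qed.

(** A singleton has no children, because parents have at least two elements. *)
Lemma cadj_foot v w : #|val v| = 1%N -> cadj v w = (w == par v).
Proof.
move=> v1; rewrite cadjE cfoot_root //; case: eqVneq => //= _.
by apply/negP => /andP[/card_par + /eqP e]; rewrite -e v1.
Qed.

(** * The corresponding curve is a labeled tropical curve *)

Variable c : 'rV[K]_r.+1.
Local Notation T := (corresponding_trop nu i0 a c).
Local Notation cpos := (cpos c).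
Local Notation ssum := (ssum R).

(** Three neighbours are the child [x] containing a label [l], the child [y] containing a label [m]
    outside [x], and the neighbour [z] above [v], which at the root is replaced by the foot of
    i_0. *)
Lemma valence_gt2 v : #|val v| != 1%N -> (2 < valence (T := T) v)%N.
Proof.
move=> v1; have nv := card_nuvertex v1; have {}v1 := card_inner v1.
have /set0Pn[l lv] := nuvertex_neq0 nv.
have [c0 cr pc lc] := cchild_spec nv v1 lv; move: (cchild v l) c0 cr pc lc => x c0 cr pc lc.
have [_ /properP[_ [m mx mv]] _] := par_spec c0 cr; rewrite pc in mx.
have [d0 dr pd md] := cchild_spec nv v1 mx; move: (cchild v m) d0 dr pd md => y d0 dr pd md.
pose z := if v == croot then cfoot0 else par v.
have xy : x != y by apply: contraNneq mv => ->.
(* Ranks increase towards the root, so a child of [v] is not its parent. *)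
have zz u : u != cfoot0 -> u != croot -> par u = v -> u != z.
  rewrite /z => u0 ur pu; case: (eqVneq v croot) => [_|vr]; [exact: u0|].
  apply/eqP => uz.
  have h1 := crank_par vr; have h2 := crank_par ur.
  by rewrite -uz in h1; rewrite pu in h2; have := ltn_trans h1 h2; rewrite ltnn.
have sub : [set x; y; z] \subset [set w | cadj v w].
  apply/subsetP => u; rewrite !inE -orbA => /or3P[] /eqP ->; rewrite cadjE.
  - by rewrite cr pc eqxx orbT.
  - by rewrite dr pd eqxx orbT.
  - rewrite /z; case: (eqVneq v croot) => [->|vr]; last by rewrite eqxx.
    by apply/orP; right; rewrite /par eqxx eqxx andbT eq_sym croot_neq_cfoot0.
apply: leq_trans (subset_leq_card sub).
rewrite setUC cardsU1 cards2 xy !inE negb_or eq_sym zz //.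
by rewrite eq_sym zz.
Qed.

Lemma valence_foot v : #|val v| = 1%N -> valence (T := T) v = 1%N.
Proof.
move=> v1; rewrite /valence -(cards1 (par v)); congr #|pred_of_set _|.
by apply/setP => w; rewrite !inE /= cadj_foot.
Qed.

Lemma is_footE v : is_foot (T := T) v = (#|val v| == 1%N).
Proof.
rewrite /is_foot; have [/valence_foot -> //|/valence_gt2] := eqVneq #|val v| 1%N.
by case: valence => [|[|n]].
Qed.

Lemma corresponding_is_abstract : is_abstract_trop_curve T.
Proof.
split.
- split; [exact: cadj_sym | exact: rooted_irr cadjE crank_par | |].
    exact: rooted_connect cadjE crank_par.
  exact: rooted_acyclic cadjE crank_par.
- move=> v; have [/valence_foot -> //|/valence_gt2] := eqVneq #|val v| 1%N.
  by case: valence => [|[|[|n]]].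
(* The feet alone are |L| + 1 distinct vertices, hence at least three. *)
- rewrite neq_ltn; apply/orP; right; apply: leq_trans (leq_card _ cfoot_inj).
  by have := L_gt1; rewrite /Lset cardsC1; case: #|_|.
(* Every edge joins a vertex to its parent. The parent is never a foot, so the length is infinite
   exactly when the lower end is a singleton. *)
have len_par v : v != croot -> (0 < nuset (val v) - nuset (val (par v)))%E /\
    ((nuset (val v) - nuset (val (par v)))%E = +oo%E <->
     is_foot (T := T) v \/ is_foot (T := T) (par v)).
  move=> vr; have fp := nuset_par vr; rewrite sube_gt0 nuset_par_lt //; split=> //.
  have -> : is_foot (T := T) (par v) = false.
    by rewrite is_footE; apply/eqP => e; have := card_par vr; rewrite e.
  rewrite is_footE -nuset_pinfty; split=> [e|[/eqP->|//]].
    left; apply: contraTT isT => h.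
    have : (nuset (val v) - nuset (val (par v)))%E \is a fin_num.
      by rewrite fin_numB fp fin_numE h gt_eqF // nuset_gtNy.
    by rewrite e.
  by rewrite -(fineK fp).
move=> v w; rewrite /= cadjE => /orP[/andP[vr /eqP ->]|/andP[wr /eqP ->]].
  by have [-> ->] := clen_par vr; have [] := len_par v vr.
have [-> ->] := clen_par wr; have [h1 h2] := len_par w wr; split=> //.
by rewrite h2; split; case; auto.
Qed.

Lemma root_pathP v : root_uniq_path cadj croot v (root_path v).
Proof.
exact: (classical_sets.xgetPex _ (root_uniq_path_exists cadjE crank_par v)).
Qed.

Lemma root_path_croot : root_path croot = [::].
Proof.
by apply: (root_uniq_path_uniq cadjE (root_pathP _)); split.
Qed.

Lemma cpos_croot : cpos croot = \sum_i tscale (fine (nu (c 0 i))) (svec R i).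
Proof. by rewrite /Defs.cpos root_path_croot big_nil addr0. Qed.

(** The root path of [v] is that of its parent followed by [v], so the sum gains one term. *)
Lemma cpos_par v : v != croot ->
  cpos v = cpos (par v) + tscale (fine (clen v (par v))) (ssum (val v)).
Proof.
move=> vr; have [q eq hq] := root_uniq_path_rcons cadjE vr (root_pathP v).
have eq' := root_uniq_path_uniq cadjE hq (root_pathP (par v)).
have [_ _ lq] := hq.
by rewrite /Defs.cpos eq zip_cons_rcons big_rcons /= lq -eq' addrA.
Qed.

(** On a bounded edge, [cpos_par] gives the displacement, and division by the nonzero length leaves
    s of the lower end, with a minus sign when climbing. On a leg the direction is given by
    [tleg]. *)
Lemma direction_corresponding v w : ~~ is_foot (T := T) v -> cadj v w ->
  direction (T := T) v w =
    if (v != croot) && (w == par v) then - ssum (val v) else ssum (val w).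
Proof.
rewrite is_footE => v1; have fin_len (u : V) : #|val u| != 1%N -> u != croot ->
    fine (nuset (val u) - nuset (val (par u)))%E != 0.
  move=> u1 ur; rewrite fineB ?nuset_par //; last first.
    by rewrite nuset_fin ?card_inner // nuvertex_sub ?card_nuvertex.
  rewrite subr_eq0 gt_eqF // -lte_fin !fineK ?nuset_par ?nuset_par_lt //.
  by rewrite nuset_fin ?card_inner // nuvertex_sub ?card_nuvertex.
rewrite cadjE /direction is_footE /=; case: andP => [[vr /eqP ->] _|_ /=].
  have := card_par vr; case: eqVneq => [-> //|_ _].
  rewrite (cpos_par vr); have [-> _] := clen_par vr.
  rewrite opprD addrA subrr add0r -tscaleN tscaleA mulVf ?tscale1 //.
  exact: fin_len.
move=> /andP[wr /eqP ->]; case: ifP => // /negbT w1.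
rewrite (cpos_par wr); have [-> ->] := clen_par wr.
by rewrite [_ + tscale _ _]addrC addrK tscaleA mulVf ?tscale1 ?fin_len.
Qed.

Lemma ssum_cfoot0 : ssum (val cfoot0) = 0.
Proof. by rewrite ssum1. Qed.

(** The map [cchild v] sorts the labels of [v] by the child containing them. The foot of i_0, a
    child of the root in the tree but not a subset of it, contributes 0. *)
Lemma ssum_children v : nuvertex (val v) -> (1 < #|val v|)%N ->
  \sum_(w | (w != croot) && (v == par w)) ssum (val w) = ssum (val v).
Proof.
move=> nv v1; rewrite (bigID (pred1 cfoot0)) /= big1 ?add0r; last first.
  by move=> w /andP[_ /eqP ->]; rewrite ssum_cfoot0.
rewrite [RHS]ssumE.
rewrite (partition_big (cchild v) (fun w => (w != croot) && (v == par w) && (w != cfoot0)))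
  /=; last first.
  by move=> l lv; have [-> -> -> _] := cchild_spec nv v1 lv; rewrite eqxx.
apply: eq_bigr => w /andP[/andP[wr /eqP vw] w0]; rewrite ssumE.
apply: eq_bigl => l; apply/idP/andP => [lw|[lv /eqP <-]]; last first.
  by have [] := cchild_spec nv v1 lv.
split; last by rewrite -(cchild_uniq w0 wr _ lw).
by have [_ /proper_sub/subsetP + _] := par_spec w0 wr; rewrite -vw; apply.
Qed.

(** The parent contributes -s_v and the children together s_v. The root has no parent, but there s_L
    = 0. *)
Lemma corresponding_balanced v : ~~ is_foot (T := T) v ->
  \sum_(w | cadj v w) direction (T := T) v w = 0.
Proof.
move=> vf; have := vf; rewrite is_footE => v1.
have nv := card_nuvertex v1; have {}v1 := card_inner v1.
under eq_bigr => w vw do rewrite direction_corresponding //.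
rewrite (bigID (fun w => (v != croot) && (w == par v))) /=.
rewrite (eq_bigr (fun=> - ssum (val v))) => [|w /andP[_ ->] //].
rewrite [X in _ + X](eq_bigr (fun w => ssum (val w))); last first.
  by move=> w /andP[_ /negPf->].
(* A neighbour other than the parent is a child, and by rank none is both. *)
rewrite [X in _ + X](eq_bigl (fun w => (w != croot) && (v == par w))); last first.
  move=> w; rewrite cadjE; case: (boolP (_ && (w == _))) => [/andP[vr /eqP ->]|_] /=;
    last by rewrite andbT.
  apply/esym/negP => /andP[pr /eqP e].
  by have := ltn_trans (crank_par vr) (crank_par pr); rewrite -e ltnn.
rewrite ssum_children //; have [->|vr] := eqVneq v croot.
  rewrite val_croot ssum_Lset addr0 big1 // => w /andP[_ /=].
  by rewrite ?andbF.
rewrite (big_pred1 (par v)) ?addNr // => w.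
by rewrite cadjE vr /=; case: eqVneq; rewrite ?andbF.
Qed.

Lemma corresponding_is_lab : is_lab_trop_curve T.
Proof.
split; first exact: corresponding_is_abstract.
- split; first exact: cfoot_inj.
  move=> v; rewrite is_footE; split=> [/cards1P[l e]|[l ->]].
    by exists l; apply/val_inj; rewrite e val_cfoot.
  by rewrite /= val_cfoot cards1.
- move=> v w vf vw; rewrite direction_corresponding //; case: ifP => _.
    exact/in_latticeN/ssum_lattice.
  exact: ssum_lattice.
- exact: corresponding_balanced.
- by split=> [i j|i]; rewrite /= val_cfoot ssum1.
Qed.

(** * Distances between inner vertices *)

Definition height v : R := fine (nuset (val v)).

Lemma heightE v : (1 < #|val v|)%N -> nuset (val v) = (height v)%:E.
Proof.
move=> v1; rewrite fineK // nuset_fin // nuvertex_sub // card_nuvertex //.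
by rewrite gtn_eqF.
Qed.

Lemma clen_height v : v != croot -> (1 < #|val v|)%N ->
  clen v (par v) = (height v - height (par v))%:E /\
  clen (par v) v = (height v - height (par v))%:E.
Proof.
by move=> vr v1; have [-> ->] := clen_par vr; rewrite !heightE // card_par.
Qed.

(** Climbing from [v] through successive parents reaches [u], and the edge lengths telescope; the
    reversed walk has the same length. *)
Lemma has_walk_height v u : (1 < #|val v|)%N -> val v \subset val u ->
  nuvertex (val u) ->
  has_walk (T := T) v u (height v - height u) /\
  has_walk (T := T) u v (height v - height u).
Proof.
have [n] := ubnP (#|val u| - #|val v|).
elim: n v => // n IH v lt_n v1 vu nu_u.
have [->|nvu] := eqVneq v u.
  by rewrite subrr; split; exact: has_walk_refl.
have nv : nuvertex (val v) by rewrite card_nuvertex // gtn_eqF.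
have pvu : val v \proper val u by rewrite properEneq (inj_eq val_inj) nvu.
have vr : v != croot.
  apply: contraTneq pvu => ->; rewrite val_croot properE.
  by rewrite (nuvertex_sub nu_u) andbF.
have v0 : v != cfoot0 by rewrite -nuvertex_inner.
have [np vp min_p] := par_spec v0 vr; have pu := min_p _ nu_u pvu.
have [|up down] := IH (par v) _ (card_par vr) pu nu_u.
  by apply: leq_trans (ltn_sub2l (proper_card pvu) (proper_card vp)) lt_n.
have [e1 e2] := clen_height vr v1; have vpv := cadj_par vr.
have -> : height v - height u = (height v - height (par v)) + (height (par v) - height u).
  by rewrite addrA subrK.
split; first exact: has_walk_trans (has_walk_edge (T := T) vpv e1) up.
have pv : cadj (par v) v by rewrite cadj_sym.
rewrite addrC; exact: has_walk_trans down (has_walk_edge (T := T) pv e2).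
Qed.

Lemma inner_sub v : (1 < #|val v|)%N -> val v \subset L.
Proof. by move=> v1; rewrite nuvertex_sub // card_nuvertex // gtn_eqF. Qed.

Lemma inner_setU_fin v w : (1 < #|val v|)%N -> (1 < #|val w|)%N ->
  nuset (val v :|: val w) \is a fin_num.
Proof.
move=> v1 w1; rewrite nuset_fin ?subUset ?inner_sub //.
by apply: leq_trans v1 _; rewrite subset_leq_card ?subsetUl.
Qed.

Definition tree_dist v w : R :=
  height v + height w - 2 * fine (nuset (val v :|: val w)).

(* By [nuset_setU], passing from v to its parent lowers the height of the join
   with w by at most as much as the height of v. *)
Lemma tree_dist_par v w : (1 < #|val w|)%N -> (1 < #|val v|)%N -> v != croot ->
  `|tree_dist v w - tree_dist (par v) w| <= height v - height (par v).
Proof.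
move=> w1 v1 vr; rewrite /tree_dist; have p1 := card_par vr.
have nv : nuvertex (val v) by rewrite card_nuvertex // gtn_eqF.
have v0 : v != cfoot0 by rewrite -nuvertex_inner.
have [_ vp _] := par_spec v0 vr.
have /set0Pn[l lv] := nuvertex_neq0 nv.
have fp := inner_setU_fin p1 w1; have fv := inner_setU_fin v1 w1.
have lJ : (nuset (val (par v) :|: val w) <= nuset (val v :|: val w))%E.
  by rewrite nusetS // setSU // proper_sub.
have lH := ltW (nuset_par_lt vr).
have lV := nusetS (subsetUl (val v) (val w)).
have := nuset_setU (subsetP (proper_sub vp) _ lv) (subsetP (subsetUl _ (val w)) _ lv).
rewrite setUA (setUidPl (proper_sub vp)) ge_min.
move: lH lJ lV; rewrite (heightE v1) (heightE p1) -(fineK fp) -(fineK fv) !lee_fin.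
move: (fine _) (fine _) (height v) (height (par v)) (height w).
move=> {fp fv} x y hv hp hw lH lJ lV /orP[] le;
  rewrite ler_norml; apply/andP; split=> /=; lra.
Qed.

(** Edges at a foot have infinite length, so only bounded edges need the Lipschitz estimate. *)
Lemma tree_dist_edge v u w : (1 < #|val w|)%N -> cadj v u ->
  ((tree_dist v w - tree_dist u w)%:E <= clen v u)%E.
Proof.
move=> w1; have len_foot x : x != croot -> ~~ (1 < #|val x|)%N ->
    (nuset (val x) - nuset (val (par x)) = +oo)%E.
  move=> xr; rewrite -leqNgt => x1; have /eqP -> : nuset (val x) == +oo%E.
    by rewrite nuset_pinfty eqn_leq x1 card_cvert_gt0.
  by rewrite -(fineK (nuset_par xr)).
rewrite cadjE => /orP[/andP[vr /eqP ->]|/andP[ur /eqP ->]].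
  have [e _] := clen_par vr; rewrite e; have [v1|/len_foot-> //] := boolP (1 < #|val v|)%N.
    rewrite -e; have [-> _] := clen_height vr v1; rewrite lee_fin.
    exact: le_trans (ler_norm _) (tree_dist_par w1 v1 vr).
  by rewrite leey.
have [_ e] := clen_par ur; rewrite e; have [u1|/len_foot-> //] := boolP (1 < #|val u|)%N.
  rewrite -e; have [_ ->] := clen_height ur u1; rewrite lee_fin.
  by apply: le_trans (ler_norm _) _; rewrite distrC; exact: tree_dist_par.
by rewrite leey.
Qed.

Lemma vdist_tree_dist v w : (1 < #|val v|)%N -> (1 < #|val w|)%N ->
  vdist (T := T) v w = (tree_dist v w)%:E.
Proof.
move=> v1 w1; apply: vdist_eq.
  (* The walk turns around at the hull of the union. *)
  have [||u [nu_u]] := @nuvertex_hull (val v :|: val w).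
  - by rewrite -card_gt0 (leq_trans (ltnW v1)) // subset_leq_card ?subsetUl.
  - by rewrite subUset !inner_sub.
  have [x xu] := nuvertex_val nu_u; subst u; rewrite subUset => /andP[vx wx] e.
  have [up _] := has_walk_height v1 vx nu_u.
  have [_ down] := has_walk_height w1 wx nu_u.
  have -> : tree_dist v w = (height v - height x) + (height w - height x).
    by rewrite /tree_dist -e -/(height x); lra.
  exact: has_walk_trans up down.
(* The bound [v1] is dropped because a walk may pass through feet; the edge estimate only asks that
   [w] be inner. *)
move=> p; elim: p v {v1} => [|u p IH] v /=.
  move=> _ ->; rewrite walk_length_nil /tree_dist setUid -/(height w).
  by rewrite lee_fin; lra.
move=> /andP[vu pu] lu; rewrite walk_length_cons.
rewrite -[tree_dist v w](subrK (tree_dist u w)) EFinD leeD ?IH //.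
exact: tree_dist_edge.
Qed.

(** * Distances between legs and the tropical point *)

Lemma leg_vertexE l : leg_vertex T l = par (cfoot l).
Proof.
have l1 : #|val (cfoot l)| = 1%N by rewrite val_cfoot cards1.
rewrite /leg_vertex; case: pickP => [v|/(_ (par (cfoot l)))] /=.
  by rewrite cadj_foot // => /eqP.
by rewrite cadj_foot // eqxx.
Qed.

Lemma leg_vertex_i0 : leg_vertex T (inl i0) = croot.
Proof. by rewrite leg_vertexE cfootE /par eqxx. Qed.

Lemma cfoot_neq_croot l : cfoot l != croot.
Proof. by apply: cfoot_root; rewrite val_cfoot cards1. Qed.

Lemma leg_vertex_inner l : (1 < #|val (leg_vertex T l)|)%N.
Proof. by rewrite leg_vertexE card_par // cfoot_neq_croot. Qed.

(** The hull of {l, m} contains the parents of both feet, so their union lies between {l, m} and its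
    hull, which have the same value. *)
Lemma nuset_leg_vertices l m : l != inl i0 -> m != inl i0 -> l != m ->
  nuset (val (leg_vertex T l) :|: val (leg_vertex T m)) = nu (a m - a l).
Proof.
move=> li0 mi0 lm; rewrite !leg_vertexE.
have par_l x (xi0 : x != inl i0) : x \in val (par (cfoot x)) /\
    forall B, nuvertex B -> [set x] \proper B -> val (par (cfoot x)) \subset B.
  have x0 : cfoot x != cfoot0 by rewrite -cfootE (inj_eq cfoot_inj).
  have [_ xp min_x] := par_spec x0 (cfoot_neq_croot x); rewrite val_cfoot in xp min_x.
  by split=> //; move: (proper_sub xp); rewrite sub1set.
have [lv min_l] := par_l l li0; have [mw min_m] := par_l m mi0.
move: (par (cfoot l)) (par (cfoot m)) lv mw min_l min_m => v w lv mw min_l min_m.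
apply/le_anti/andP; split; first by apply: nuset_le; rewrite in_setU ?lv ?mw ?orbT.
rewrite -nuset2; have [||u [nu_u]] := @nuvertex_hull [set l; m].
- by apply/set0Pn; exists l; rewrite set21.
- by apply/subsetP => x; rewrite !inE => /orP[]/eqP->.
rewrite subUset !sub1set => /andP[lu mu] <-; apply: nusetS.
have u2 : (1 < #|u|)%N by apply/card_gt1P; exists l, m.
by rewrite subUset min_l ?min_m // properEcard sub1set cards1 ?lu ?mu.
Qed.

(** The valuation of the bracket for p_{i_0} = (0:1) and p_l = (1:a_l): brackets involving i_0 are 1
    or -1. *)
Definition pair_valuation l m : R :=
  if (l == inl i0) || (m == inl i0) then 0 else fine (nu (a m - a l)).

(** The vector whose image under [Phi] separates -dist/2 from [pair_valuation]. The sign changes at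
    i_0 because the join with the root is the root: there the distance is [height (leg_vertex T l)]
    minus [height croot]. *)
Definition leg_shift l : R :=
  (if l == inl i0 then height croot else - height (leg_vertex T l)) / 2.

Lemma ldistE l m : l != m ->
  - ldist T l m / 2 = pair_valuation l m + (leg_shift l + leg_shift m).
Proof.
move=> lm; rewrite /ldist vdist_tree_dist ?leg_vertex_inner //= /tree_dist.
have sub x : val (leg_vertex T x) \subset val croot.
  by rewrite val_croot inner_sub // leg_vertex_inner.
rewrite /pair_valuation /leg_shift; case: (eqVneq l (inl i0)) => [li0|li0] /=.
  have mi0 : m != inl i0 by rewrite -li0 eq_sym.
  rewrite (negPf mi0) li0 leg_vertex_i0 (setUidPl (sub m)) -/(height croot).
  by move: (height _) (height _) => x y; lra.
case: (eqVneq m (inl i0)) => [mi0|mi0] /=.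
  rewrite mi0 leg_vertex_i0 (setUidPr (sub l)) -/(height croot).
  by move: (height _) (height _) => x y; lra.
rewrite nuset_leg_vertices //.
by move: (fine _) (height _) (height _) => x y z; lra.
Qed.

Lemma trop_point_ident (m : charlattice L0 r) : (forall i, c 0 i != 0) ->
  trop_ident (trop_point T i0) m =
    \sum_(p : dpairs L0) ((val m).1 p)%:~R * pair_valuation (val p).1 (val p).2
    + \sum_(i < r.+1) ((val m).2 i)%:~R * fine (nu (c 0 i)).
Proof.
move=> c0; rewrite /trop_point /trop_ev leg_vertex_i0 /= cpos_croot.
pose v : 'rV[R]_r.+1 := \row_i fine (nu (c 0 i)).
have -> : \sum_i tscale (fine (nu (c 0 i))) (svec R i) = tclass v.
  rewrite [v]row_sum_delta tclass_sum; apply: eq_bigr => i _.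
  by rewrite mxE -tscale_tclass.
rewrite trop_ident_class; congr (_ + _); last first.
  by apply: eq_bigr => i _; rewrite mxE.
(* Characters vanish on the image of [Phi], so the shift drops out. *)
rewrite -[RHS]addr0 -[X in _ + X](sum_pair_Phi m leg_shift) -big_split /=.
by apply: eq_bigr => p _; rewrite !ffunE ldistE ?mulrDr // (valP p).
Qed.
End Balls.

(** * The tropicalization of the algebraic point *)

Section CurvePoint.
Local Open Scope ring_scope.
Variables (R : realType) (K : fieldType) (nu : K -> \bar R).
Hypothesis hnu : valuation nu.
Variables (I : finType) (r d : nat) (i0 : I).
Variables (C : lab_curve K I r d) (a : label I r d -> K).
Hypothesis hC : standard_form i0 C.
Hypothesis ha : forall l, l != inl i0 -> has_coords (mark C l) (vec2 1 (a l)).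

Lemma has_coords_inj n (P Q : proj K n) v :
  has_coords P v -> has_coords Q v -> P = Q.
Proof. by move=> [x [-> ->]] [y [-> /val_inj ->]]. Qed.

Lemma has_coords_hc n (P : proj K n) v : has_coords P v ->
  exists2 t, t != 0 & hc P = t *: v.
Proof.
move=> /has_coordsP[t t0 ->]; exists t^-1; first by rewrite invr_eq0.
by rewrite scalerA mulVf ?scale1r.
Qed.

Lemma standard_form_inj : {in [set~ inl i0] &, injective a}.
Proof.
move=> l m; rewrite !inE => li0 mi0 e; apply: (@mark_inj _ _ _ _ C).
by apply: has_coords_inj (ha li0) _; rewrite e; exact: ha.
Qed.

(** The representatives chosen by [hc] are arbitrary; [t] records how they differ from the standard
    ones. *)
Lemma hc_mark : exists t : label I r d -> K, forall l, t l != 0 /\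
  hc (mark C l) = t l *: (if l == inl i0 then vec2 0 1 else vec2 1 (a l)).
Proof.
suff h l : exists t, t != 0 /\
    hc (mark C l) = t *: (if l == inl i0 then vec2 0 1 else vec2 1 (a l)).
  by have [t ht] := boolp.choice h; exists t.
have [->|/ha/has_coords_hc[t t0 e]] := eqVneq l (inl i0); last by exists t.
by have [t t0 e] := has_coords_hc hC; exists t.
Qed.

(** Rescaling the coordinates multiplies the bracket of l, m by t_l t_m, which changes the
    valuations by an element of the image of [Phi]. *)
Lemma fine_valuation_brackets : exists tau : label I r d -> R,
  forall p, fine (nu (val (brackets C) p)) =
    pair_valuation nu i0 a (val p).1 (val p).2 + Phi tau p.
Proof.
have [t ht] := hc_mark; exists (fun l => fine (nu (t l))) => p.
rewrite !ffunE /bracket; have [t1 ->] := ht (val p).1; have [t2 ->] := ht (val p).2.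
have np := valP p; move: (val p).1 (val p).2 np t1 t2 => l m lm t1 t2.
rewrite /pair_valuation !mxE /=.
(* Here [y] is the bracket in standard coordinates: -1, 1 or a_m - a_l. *)
set x := _ - _; suff [y [y0 -> <-]] : exists y, [/\ y != 0, x = t l * t m * y
    & fine (nu y) = if (l == inl i0) || (m == inl i0) then 0 else fine (nu (a m - a l))].
  by rewrite !fine_valuationM ?mulf_neq0 // addrC.
rewrite {}/x; case: (eqVneq l (inl i0)) => [li0|li0] /=.
  have /negPf mi0 : m != inl i0 by rewrite -li0 eq_sym.
  exists (-1); rewrite oppr_eq0 oner_neq0 valuationN // fine_valuation1 //.
  by rewrite mi0 !mxE /=; split=> //; ring.
case: (eqVneq m (inl i0)) => [mi0|mi0] /=.
  exists 1; rewrite oner_neq0 fine_valuation1 //.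
  by rewrite !mxE /=; split=> //; ring.
exists (a m - a l); split=> //; last by rewrite !mxE /=; ring.
rewrite subr_eq0; apply: contra_neq lm => e; apply/esym.
by apply: standard_form_inj; rewrite ?inE.
Qed.

Lemma tropicalization_curve_point (c : 'rV[K]_r.+1) m :
  has_coords (cmap C (mark C (inl i0))) c ->
  (forall i, c 0 i != 0) /\
  tropicalization nu (curve_point C i0) m =
    \sum_(p : dpairs (label I r d))
      ((val m).1 p)%:~R * pair_valuation nu i0 a (val p).1 (val p).2
    + \sum_(i < r.+1) ((val m).2 i)%:~R * fine (nu (c 0 i)).
Proof.
(* The marking i_0 differs from all p_{ij}, so its image lies in the torus. *)
move=> hf; have c0 i : c 0 i != 0.
  have [t t0 e] := has_coords_hc hf.
  have /forallP/(_ i) := cmap_torus C i0; rewrite /coord_zero e mxE.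
  by rewrite mulf_eq0 (negPf t0).
split=> //; rewrite /tropicalization /curve_point.
rewrite (@char_eval_coords _ _ _ m (brackets C) (ev C i0) c hf).
have b0 p : val (brackets C) p != 0 by exact: (forallP (valP (brackets C))).
rewrite fine_valuationM ?monomial_neq0 // !fine_valuation_monomial //.
congr (_ + _); have [tau htau] := fine_valuation_brackets.
rewrite -[RHS]addr0 -[X in _ + X](sum_pair_Phi m tau) -big_split /=.
by apply: eq_bigr => p _; rewrite htau mulrDr.
Qed.

End CurvePoint.

Theorem proposition3p3 (R : realType) (K : closedFieldType)
  (charK : [pchar K]%R =i pred0)
  (nu : K -> \bar R) (hnu : valuation nu)
  (I : finType) (r d : nat) (hr : 0 < r) (i0 : I)
  (hL0 : 3 <= #|label I r d|)
  (C : lab_curve K I r d) (hC : standard_form i0 C)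
  (a : label I r d -> K)
  (ha : forall l, l != inl i0 -> has_coords (mark C l) (vec2 1%R (a l)))
  (c : 'rV[K]_r.+1) (hf : has_coords (cmap C (mark C (inl i0))) c) :
  is_lab_trop_curve (corresponding_trop nu i0 a c) /\
  trop_ident (trop_point (corresponding_trop nu i0 a c) i0) =
    tropicalization nu (curve_point C i0).
Proof.
have a_inj := standard_form_inj ha.
have L_gt1 : 1 < #|Lset r d i0| by rewrite /Lset cardsC1; case: #|_| hL0 => [|[]].
split; first exact: corresponding_is_lab.
(* Both points are compared at each character, where they have the same explicit value. *)
apply: boolp.funext => m.
have [c0 ->] := tropicalization_curve_point hnu hC ha m hf.
exact: trop_point_ident.
Qed.
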